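(* Let $E$ be a closed subset of the unit circle $\mathbb{T}$ of positive Lebesgue measure. Then, for any sequence $(u_n)_{n\ge1}$ of positive real numbers with $u_n\to\infty$, there exist a complex Hilbert space and a bounded linear operator $T$ on it with $\|T\|\le1$ such that $\sigma(T)\subset E$, $\|T^{-n}\|=O(u_n)$ as $n\to\infty$, and $\operatorname{rank}(I-T^*T)=1$, but $\sup_{n}\|T^{-n}\|=\infty$.
   Context: $\mathbb{T}=\{z\in\mathbb{C}:|z|=1\}$, and $\sigma(T)$ denotes the spectrum of $T$. Since $\sigma(T)\subset\mathbb{T}$, $T$ is invertible, and $T^{-n}=(T^{-1})^n$ for $n\ge1$. *)

(* Defs.v *)
From HB Require Import structures.
From mathcomp Require Export all_boot all_order all_algebra sesquilinear.
From mathcomp Require Export complex.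
From mathcomp Require Export all_classical all_reals all_analysis.
Export numFieldNormedType.Exports.

Set Implicit Arguments.
Unset Strict Implicit.
Unset Printing Implicit Defensive.

Import Order.TTheory GRing.Theory Num.Theory.

Local Open Scope classical_set_scope.
Local Open Scope complex_scope.
Local Open Scope ring_scope.

(* A complex Hilbert space; [dot] is linear in its first argument. *)
Record hilbertType (R : realType) := HilbertType {
  hilbert_sort :> completeNormedModType R[i];
  dot : {dot hilbert_sort for @Num.conj R[i]};
  dotE : forall x : hilbert_sort, `|x| ^+ 2 = dot x x
}.

Definition unit_circle (R : realType) : set R[i] := [set z | `|z| = 1].

(* Arc length (Lebesgue) measure of a subset of the unit circle. *)
Definition circle_measure (R : realType) (A : set R[i]) : \bar R :=
  @lebesgue_measure R
    [set t : R | 0 <= t < 2 * pi /\ A (cos t +i* sin t)].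

Definition bounded_operator (R : realType) (H : hilbertType R) (T : H -> H) :
    Prop :=
  exists M : R, forall x, `|T x| <= M%:C * `|x|.

(* Norms in [H] take values in the nonnegative reals of [R[i]]. *)
Definition opnorm (R : realType) (H : hilbertType R) (T : H -> H) : R :=
  sup [set complex.Re `|T x| | x in [set x : H | `|x| <= 1]].

Definition inverse_operator (R : realType) (H : hilbertType R)
    (T : H -> H) (S : {linear H -> H}) : Prop :=
  [/\ bounded_operator S, cancel T S & cancel S T].

Definition spectrum (R : realType) (H : hilbertType R) (T : {linear H -> H}) :
    set R[i] :=
  [set l | ~ exists S, inverse_operator (fun x => T x - l *: x) S].

Definition adjoint_operator (R : realType) (H : hilbertType R)
    (T S : {linear H -> H}) : Prop :=
  bounded_operator S /\ forall x y, dot H (T x) y = dot H x (S y).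

(* The range of [A] has a basis of [r] vectors. *)
Definition has_rank (R : realType) (H : hilbertType R) (A : H -> H) (r : nat) :
    Prop :=
  exists e : 'I_r -> H,
    (forall c : 'I_r -> R[i],
       \sum_(i < r) c i *: e i = 0 -> forall i, c i = 0) /\
    range A = [set \sum_(i < r) c i *: e i | c in [set: 'I_r -> R[i]]].

(* Main.v *)
(* Write z = e^(it) and let w > 0 be a weight on a subset of E. On functions f on that
   subset put |f|^2 = int |f|^2 w dt + sum_(k >= 0) |int z^k f dt|^2, and let T be the
   multiplication by z. Then |f|^2 - |T f|^2 = |int f dt|^2, so T is a contraction with
   a defect of rank one, and |T^-n f|^2 - |f|^2 = sum_(1 <= k <= n) |int z^-k f dt|^2.
   By duality this sum is at most kappa_n int |f|^2 w dt as soon as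
   int |q|^2 / w dt <= kappa_n int |q|^2 dt for all trigonometric polynomials q of
   length n. The weight is 1 / (j + 1) on the block B_j: taking the blocks small makes
   kappa_n = O(u_n). Taking B_j to fill half of a short interval around a density point
   of E makes the Fourier coefficients of its indicator large, so that T^-n is unbounded.

   For lam outside E the resolvent is the multiplication by 1 / (z - lam), and the point
   is to bound the coefficients b_n = int z^n f / (z - lam) dt, which satisfy
   b_(n+1) = lam b_n + a_n with a_n = int z^n f dt. This is direct unless |lam| = 1. In
   that case a summation by parts shows that the sums over n < N of
   |int z^n f / (z - lam)^k dt|^2 are almost convex in k after a geometric rescaling,
   while they grow at most geometrically in k; hence the sum for k = 1 is controlled by
   the one for k = 0, uniformly in N. *)

(* The weighted part of the norm is invariant under multiplication by powers of z, so all growth of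
   T^-n sits in the coefficients. The weight is small on late blocks, but the sum of (j + 1) |B_j|
   is finite, so the weighted norm still controls int |f| dt.

   The indicator of B_j alone is not a good test vector, since its own coefficients of index k >= 0
   count in its norm. Multiplying first by a high power of z shifts them away and leaves a squared
   norm of order |B_j| / (j + 1); going back far enough then produces at least c |B_j| / 4.

   For |lam| = 1 the recursion alone does not make b square-summable when a is. The missing
   information is that z - lam stays at distance d > 0 from 0 on E, so that for every k the
   coefficients of f / (z - lam)^k are O(d^-k), uniformly in their index.

   The defect identity gives I - T^* T = <., e> e, where e represents f -> int f dt; T being
   invertible, this yields T^* in closed form. All estimates are made on functions carried by
   finitely many blocks, where 1 / w is bounded, and pass to the completion by density. *)
From HB Require Import structures.
Require Import Defs.
From mathcomp Require Import measurable_realfun ring lra.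

Set Implicit Arguments.
Unset Strict Implicit.
Unset Printing Implicit Defensive.

Import Order.TTheory GRing.Theory Num.Theory.
Import Normc.

Local Open Scope classical_set_scope.
Local Open Scope complex_scope.
Local Open Scope ring_scope.

(** * Moduli of complex numbers *)

Section ComplexModulus.
Variable R : realType.
Implicit Types (z : R[i]) (r : R).

Lemma normE z : `|z| = (normc z)%:C. Proof. by []. Qed.

Lemma normc_ge0 z : 0 <= normc z.
Proof. by have := normr_ge0 z; rewrite normE lecE /= => /andP[]. Qed.

Lemma normcD z1 z2 : normc (z1 + z2) <= normc z1 + normc z2.
Proof. exact: le_normcD. Qed.

Lemma normc_opp z : normc (- z) = normc z. Proof. exact: normcN. Qed.

Lemma normcB z1 z2 : normc (z1 - z2) = normc (z2 - z1).
Proof. by rewrite -normc_opp opprB. Qed.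

Lemma normc_conj z : normc (z^*) = normc z.
Proof. by case: z => a b /=; rewrite sqrrN. Qed.


Lemma Re_conj z : complex.Re (z^*) = complex.Re z. Proof. by case: z. Qed.
Lemma Re_D z1 z2 : complex.Re (z1 + z2) = complex.Re z1 + complex.Re z2.
Proof. by case: z1; case: z2. Qed.
Lemma Re_N z : complex.Re (- z) = - complex.Re z. Proof. by case: z. Qed.
Lemma Re_Mr r z : complex.Re (r%:C * z) = r * complex.Re z.
Proof. by case: z => a b /=; rewrite mul0r subr0. Qed.

Lemma conjD z1 z2 : (z1 + z2)^* = z1^* + z2^*. Proof. exact: rmorphD. Qed.
Lemma conjB z1 z2 : (z1 - z2)^* = z1^* - z2^*. Proof. exact: rmorphB. Qed.
Lemma conjM z1 z2 : (z1 * z2)^* = z1^* * z2^*. Proof. exact: rmorphM. Qed.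

Lemma conjMr r z : (r%:C * z)^* = r%:C * z^*.
Proof. by case: z => a b; simpc. Qed.

Lemma normc_sqr z : normc z ^+ 2 = complex.Re (z * z^*).
Proof.
case: z => a b /=; rewrite sqr_sqrtr ?addr_ge0 ?sqr_ge0//.
by rewrite mulrN opprK !expr2.
Qed.

Lemma mulJ z : z * z^* = (normc z ^+ 2)%:C.
Proof.
rewrite normc_sqr; case: z => a b; apply/eqP; rewrite eq_complex /= eqxx /=.
by apply/eqP; ring.
Qed.

Lemma normc_real r : normc (r%:C) = `|r|.
Proof. by rewrite /= expr0n addr0 sqrtr_sqr. Qed.

Lemma normc_Re z : `|complex.Re z| <= normc z.
Proof. by have := normc_ge_Re z; rewrite normE lecR. Qed.

Lemma normc_Im z : `|complex.Im z| <= normc z.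
Proof.
case: z => a b /=; rewrite -[leLHS]sqrtr_sqr ler_wsqrtr//.
by rewrite lerDr sqr_ge0.
Qed.

Lemma normc_le_ReIm z : normc z <= `|complex.Re z| + `|complex.Im z|.
Proof.
case: z => a b.
have e : a +i* b = a%:C + 'i * b%:C by simpc.
rewrite [in leLHS]e; apply: (le_trans (normcD _ _)).
rewrite normcM !normc_real /= [0 ^+ 2]expr0n expr1n add0r sqrtr1 mul1r.
exact: lexx.
Qed.

Lemma eq_small z1 z2 K :
  (forall e, 0 < e -> e < 1 -> normc (z1 - z2) <= K * e) -> z1 = z2.
Proof.
move=> h; apply/eqP; rewrite -subr_eq0; apply/eqP/eq0_normc.
apply/eqP; rewrite eq_le normc_ge0 andbT leNgt; apply/negP => n0.
have K0 : 0 <= `|K| by [].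
set d := normc _ in n0 h *.
(* The factor [d + 1] keeps this [e] below 1; the factor [2 * (|K| + 1)] makes [K * e] less than
   [d]. *)
have e0 : 0 < d / ((`|K| + 1) * (d + 1) * 2).
  by rewrite divr_gt0// !mulr_gt0//; lra.
have e1 : d / ((`|K| + 1) * (d + 1) * 2) < 1.
  by rewrite ltr_pdivrMr ?mul1r; [nra|rewrite !mulr_gt0//; lra].
have := h _ e0 e1; apply/negP; rewrite -ltNge.
rewrite mulrA ltr_pdivrMr; last by rewrite !mulr_gt0//; lra.
have := ler_norm K; nra.
Qed.

(** The Cauchy rate survives the passage to the limit in [m]. An explicit rate is what later makes
    pointwise limits of functionals uniform on the unit ball, hence limits in the dual norm. *)
Lemma complex_cvg_rate (u : nat -> R[i]) (c : R) :
  (forall n m, normc (u n - u m) <= c * (n.+1%:R^-1 + m.+1%:R^-1)) ->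
  exists l, forall n, normc (l - u n) <= c * n.+1%:R^-1.
Proof.
move=> cu.
have c0 : 0 <= c.
  have := le_trans (normc_ge0 _) (cu 0 0); rewrite invr1; lra.
have real_lim (v : nat -> R) :
    (forall n m, `|v n - v m| <= c * (n.+1%:R^-1 + m.+1%:R^-1)) ->
    cvgn v.
  move=> cv; apply: cauchy_cvg; apply/cauchy_exP => e e0.
  pose N := (Num.truncn (2 * c / e)).+1.
  exists (v N); exists N => // n /= Nn; apply: le_lt_trans (cv _ _) _.
  have N0 : 0 < (N.+1%:R : R) by [].
  have Ne : 2 * c / e < N.+1%:R.
    by apply: (lt_trans (truncnS_gt _)); rewrite ltr_nat.
  have : n.+1%:R^-1 <= N.+1%:R^-1 :> R by rewrite lef_pV2 ?posrE// ler_nat ltnS.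
  move=> h; apply: (@le_lt_trans _ _ (c * (2 * N.+1%:R^-1))).
    apply: ler_wpM2l => //; move: h.
    by move: (_^-1) (_^-1) => x y; lra.
  by rewrite mulrA ltr_pdivrMr// mulrC [e * _]mulrC -ltr_pdivrMr.
have cRe : cvgn (fun n => complex.Re (u n)).
  apply: real_lim => n m; apply: le_trans (cu n m).
  by rewrite -[- complex.Re _]Re_N -Re_D normc_Re.
have cIm : cvgn (fun n => complex.Im (u n)).
  apply: real_lim => n m; apply: le_trans (cu n m).
  by apply: le_trans (normc_Im _); case: (u n) (u m) => ? ? [].
exists (lim ((fun n => complex.Re (u n)) @ \oo) +i*
        lim ((fun n => complex.Im (u n)) @ \oo)) => n.
apply/ler_addgt0Pr => e e0.
near \oo => m.
have h1 : `|lim ((fun n => complex.Re (u n)) @ \oo) - complex.Re (u m)| <= e / 3.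
  by near: m; apply: cvgr_dist_le; [exact: cRe|rewrite divr_gt0].
have h2 : `|lim ((fun n => complex.Im (u n)) @ \oo) - complex.Im (u m)| <= e / 3.
  by near: m; apply: cvgr_dist_le; [exact: cIm|rewrite divr_gt0].
have h3 : c * m.+1%:R^-1 <= e / 3.
  near: m; exists (Num.truncn (3 * c / e)) => // m /= Nm.
  have : 3 * c / e < m.+1%:R.
    by apply: (lt_le_trans (truncnS_gt _)); rewrite ler_nat ltnS.
  rewrite ltr_pdivrMr// ler_pdivrMr//; move: (m.+1%:R) => x; lra.
set l := _ +i* _.
have -> : l - u n = (l - u m) + (u m - u n) by ring.
apply: (le_trans (normcD _ _)).
have : normc (l - u m) <= e / 3 + e / 3.
  apply: (le_trans (normc_le_ReIm _)); rewrite /l.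
  by case: (u m) h1 h2 => a b /= h1 h2; rewrite lerD.
have := cu m n; move: h3; rewrite mulrDr.
move: (c * _) (c * _) (normc _) (normc _) => w x y z; lra.
Unshelve. all: by end_near. Qed.

End ComplexModulus.

(** * Pre-Hilbert spaces *)

(** Only semi-definite: functions that vanish almost everywhere will have norm 0. *)
Record preHilbert (R : realType) := PreHilbert {
  preH :> lmodType R[i];
  pdot : preH -> preH -> R[i];
  pdotP : forall a x y z, pdot (a *: x + y) z = a * pdot x z + pdot y z;
  pdotC : forall x y, pdot y x = (pdot x y)^*;
  pdot_ge0 : forall x, 0 <= complex.Re (pdot x x)
}.
Arguments pdot {R p}.

Definition pnorm (R : realType) (P : preHilbert R) (x : P) : R :=
  Num.sqrt (complex.Re (pdot x x)).

Section PreHilbertTheory.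
Variables (R : realType) (P : preHilbert R).
Implicit Types (x y z : P) (a : R[i]).

Lemma pdotDl x y z : pdot (x + y) z = pdot x z + pdot y z.
Proof. by have := pdotP 1 x y z; rewrite scale1r mul1r. Qed.

Lemma pdot0l z : pdot 0 z = 0.
Proof.
by have /eqP := pdotDl 0 0 z; rewrite addr0 -[X in X == _]addr0 (inj_eq (addrI _)) eq_sym => /eqP.
Qed.

Lemma pdotZl a x z : pdot (a *: x) z = a * pdot x z.
Proof. by have := pdotP a x 0 z; rewrite pdot0l !addr0. Qed.

Lemma pdotNl x z : pdot (- x) z = - pdot x z.
Proof. by rewrite -scaleN1r pdotZl mulN1r. Qed.

Lemma pdotBl x y z : pdot (x - y) z = pdot x z - pdot y z.
Proof. by rewrite pdotDl pdotNl. Qed.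

Lemma pdotDr x y z : pdot z (x + y) = pdot z x + pdot z y.
Proof. by rewrite !(pdotC _ z) pdotDl rmorphD. Qed.

Lemma pdotZr a x z : pdot z (a *: x) = a^* * pdot z x.
Proof. by rewrite !(pdotC _ z) pdotZl rmorphM. Qed.

Lemma pdotBr x y z : pdot z (x - y) = pdot z x - pdot z y.
Proof. by rewrite !(pdotC _ z) pdotBl rmorphB. Qed.

Lemma pdotxx x : pdot x x = (complex.Re (pdot x x))%:C.
Proof.
have := pdotC x x; case: (pdot x x) => u v /= [] h.
by congr Complex; lra.
Qed.

Lemma pnorm_ge0 x : 0 <= pnorm x. Proof. exact: sqrtr_ge0. Qed.

Lemma pnorm_sqr x : pnorm x ^+ 2 = complex.Re (pdot x x).
Proof. by rewrite sqr_sqrtr// pdot_ge0. Qed.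

Lemma pdotxxE x : pdot x x = (pnorm x ^+ 2)%:C.
Proof. by rewrite pnorm_sqr -pdotxx. Qed.

Lemma pnorm_sqrB x y : pnorm (x - y) ^+ 2 =
  pnorm x ^+ 2 - 2 * complex.Re (pdot x y) + pnorm y ^+ 2.
Proof.
rewrite !pnorm_sqr pdotBl !pdotBr (pdotC x y) !(Re_D, Re_N) Re_conj; ring.
Qed.

Lemma pnorm_sqrD x y : pnorm (x + y) ^+ 2 =
  pnorm x ^+ 2 + 2 * complex.Re (pdot x y) + pnorm y ^+ 2.
Proof.
rewrite !pnorm_sqr pdotDl !pdotDr (pdotC x y) !(Re_D, Re_N) Re_conj; ring.
Qed.

Lemma pnormZ a x : pnorm (a *: x) = normc a * pnorm x.
Proof.
apply/eqP; rewrite -(@eqrXn2 _ 2)// ?pnorm_ge0 ?mulr_ge0 ?normc_ge0 ?pnorm_ge0//.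
rewrite exprMn !pnorm_sqr pdotZl pdotZr mulrA mulJ.
by rewrite Re_Mr.
Qed.

Lemma pnorm0 : pnorm (0 : P) = 0.
Proof. by rewrite /pnorm pdot0l sqrtr0. Qed.

Lemma pnormN x : pnorm (- x) = pnorm x.
Proof. by rewrite -scaleN1r pnormZ normc_opp normc1 mul1r. Qed.

Lemma pnormBC x y : pnorm (x - y) = pnorm (y - x).
Proof. by rewrite -pnormN opprB. Qed.

(* The discriminant argument behind Cauchy-Schwarz, with [k] the squared modulus
   of the pairing. *)
Lemma discr_le (k b d : R) : 0 <= k -> 0 <= b ->
  (forall s, 2 * s * k <= s ^+ 2 * k * b + d) -> k <= d * b.
Proof.
move=> k0; rewrite le_eqVlt => /predU1P[<-|b0] h.
  rewrite mulr0 leNgt; apply/negP => kp.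
  have := h ((d + 1) / k); rewrite mulr0 add0r -mulrA divfK ?gt_eqF//.
  by have := h 0; rewrite expr0n /= !(mulr0, mul0r) add0r; lra.
have := h b^-1; have -> : b^-1 ^+ 2 * k * b = k / b by field; rewrite gt_eqF.
rewrite mulrAC -mulrA => h1; have : k / b <= d by lra.
by rewrite ler_pdivrMr.
Qed.

Lemma cauchy_schwarz x y : normc (pdot x y) <= pnorm x * pnorm y.
Proof.
rewrite -(@ler_pXn2r _ 2)// ?nnegrE ?normc_ge0 ?mulr_ge0 ?pnorm_ge0// exprMn.
apply: discr_le; rewrite ?exprn_ge0 ?normc_ge0 ?pnorm_ge0// => s.
(* The complex factor [pdot x y] fixes the phase, so that the expansion is a real quadratic
   polynomial in [s]. *)
have := sqr_ge0 (pnorm (x - (s%:C * pdot x y) *: y)).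
rewrite pnorm_sqrB pdotZr conjMr -(mulrA s%:C) (mulrC (pdot x y)^*) mulJ.
rewrite Re_Mr pnormZ normcM normc_real !exprMn real_normK ?num_real//.
move: (normc _ ^+ 2) (pnorm x ^+ 2) (pnorm y ^+ 2) => k d b /= h.
lra.
Qed.

Lemma pnormD x y : pnorm (x + y) <= pnorm x + pnorm y.
Proof.
rewrite -(@ler_pXn2r _ 2)// ?nnegrE ?addr_ge0 ?pnorm_ge0// pnorm_sqrD.
have := cauchy_schwarz x y; have := normc_Re (pdot x y).
have := ler_norm (complex.Re (pdot x y)); nra.
Qed.

Lemma pnorm_triangle x y z : pnorm (x - z) <= pnorm (x - y) + pnorm (y - z).
Proof. by have := pnormD (x - y) (y - z); rewrite addrA subrK. Qed.

Lemma pnorm_le_dual x e : 0 <= e ->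
  (forall y, normc (pdot x y) <= e * pnorm y) -> pnorm x <= e.
Proof.
move=> e0 h; have := h x; rewrite pdotxxE normc_real ger0_norm ?sqr_ge0// expr2.
have := pnorm_ge0 x; rewrite le_eqVlt => /predU1P[<-//|x0].
by rewrite ler_pM2r.
Qed.

End PreHilbertTheory.

(** * Functionals that are limits of vectors in the dual norm *)

Section Approximation.
Variables (R : realType) (P : preHilbert R).
Implicit Types (x y z : P) (f g : P -> R[i]).

Definition approximates x e f :=
  forall y, normc (f y - pdot x y) <= e * pnorm y.

Definition approximable f := forall e, 0 < e -> exists x, approximates x e f.

Definition bounded_by (M : R) f := forall y, normc (f y) <= M * pnorm y.

Lemma approximates_pdot x : approximates x 0 (pdot x).
Proof. by move=> y; rewrite subrr normc0 mul0r. Qed.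

Lemma approximable_pdot x : approximable (pdot x).
Proof.
move=> e e0; exists x => y.
by rewrite subrr normc0 mulr_ge0 ?(ltW e0) ?pnorm_ge0.
Qed.

Lemma approximates_lin a x e f y d g : approximates x e f ->
  approximates y d g -> approximates (a *: x + y) (normc a * e + d) (fun z => a * f z + g z).
Proof.
move=> xf yg z; rewrite pdotP.
have -> : a * f z + g z - (a * pdot x z + pdot y z) =
  a * (f z - pdot x z) + (g z - pdot y z).
  by ring.
apply: (le_trans (normcD _ _)); rewrite normcM mulrDl lerD// -mulrA.
by rewrite ler_wpM2l ?normc_ge0.
Qed.

Lemma approximable_lin a f g :
  approximable f -> approximable g -> approximable (fun z => a * f z + g z).
Proof.
move=> fa ga e e0; have n0 := normc_ge0 a.
have e1 : 0 < e / (2 * (normc a + 1)) by rewrite divr_gt0// mulr_gt0//; lra.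
have e2 : 0 < e / 2 by rewrite divr_gt0.
have [x xf] := fa _ e1; have [y yg] := ga _ e2.
exists (a *: x + y) => z; apply: le_trans (approximates_lin a xf yg z) _.
rewrite ler_wpM2r ?pnorm_ge0//.
have : normc a * (e / (2 * (normc a + 1))) <= e / 2.
  rewrite mulrA ler_pdivrMr; last lra.
  have -> : e / 2 * (2 * (normc a + 1)) = e * (normc a + 1) by field.
  by rewrite mulrC ler_wpM2l ?ltW//; lra.
lra.
Qed.

Lemma approximable0 : approximable (fun=> 0).
Proof.
by move=> e e0; exists 0 => y; rewrite pdot0l subr0 normc0 mulr_ge0 ?(ltW e0) ?pnorm_ge0.
Qed.

Lemma bounded_approx f x e : approximates x e f -> bounded_by (pnorm x + e) f.
Proof.
move=> xf y; rewrite -[f y](subrK (pdot x y)); apply: (le_trans (normcD _ _)).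
rewrite mulrDl addrC lerD// ?cauchy_schwarz//; exact: xf.
Qed.

Lemma approximable_bounded f : approximable f -> exists2 M, 0 <= M & bounded_by M f.
Proof.
move=> /(_ _ ltr01)[x xf]; exists (pnorm x + 1); rewrite ?addr_ge0 ?pnorm_ge0//.
exact: bounded_approx.
Qed.

Lemma pnorm_approx M f x e : 0 <= M -> 0 <= e -> bounded_by M f ->
  approximates x e f -> pnorm x <= M + e.
Proof.
move=> M0 e0 fM xf; apply: pnorm_le_dual; rewrite ?addr_ge0// => y.
have -> : pdot x y = f y + (- (f y - pdot x y)) by ring.
by apply: (le_trans (normcD _ _)); rewrite normc_opp mulrDl lerD.
Qed.

(** Additivity is inherited from the approximating pairings: each of the three values is off by a
    multiple of [e], and [e] is arbitrary. *)
Lemma approximableB f x y : approximable f -> f (x - y) = f x - f y.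
Proof.
move=> fa; apply: (@eq_small _ _ _ (pnorm (x - y) + (pnorm x + pnorm y))) => e e0 _.
have [u uf] := fa _ e0.
have -> : f (x - y) - (f x - f y) =
  (f (x - y) - pdot u (x - y)) + (- (f x - pdot u x) + (f y - pdot u y)).
  by rewrite pdotBr; ring.
apply: (le_trans (normcD _ _)); rewrite mulrC mulrDr lerD//.
by apply: (le_trans (normcD _ _)); rewrite normc_opp mulrDr lerD.
Qed.

Lemma approximates_close x y e d f : 0 <= e -> 0 <= d ->
  approximates x e f -> approximates y d f -> pnorm (x - y) <= e + d.
Proof.
move=> e0 d0 xf yf; apply: pnorm_le_dual; rewrite ?addr_ge0// => z.
have -> : pdot (x - y) z = - (f z - pdot x z) + (f z - pdot y z).
  by rewrite pdotBl; ring.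
by apply: (le_trans (normcD _ _)); rewrite normc_opp mulrDl lerD.
Qed.

Lemma invSn_gt0 n : 0 < n.+1%:R^-1 :> R. Proof. by rewrite invr_gt0. Qed.
Hint Resolve invSn_gt0 : core.

Lemma invSn_small (e : R) : 0 < e -> exists n, n.+1%:R^-1 <= e.
Proof.
move=> e0; exists (Num.truncn e^-1).
rewrite -[leRHS]invrK lef_pV2 ?posrE ?invr_gt0//; exact/ltW/truncnS_gt.
Qed.

(** The inner product of [f] and [g] is the limit of [f] along vectors approximating [g].
    Quantifying over all bounds of [f] and all approximants of [g] frees [d] from the sequence used
    to build it. *)
Lemma ex_dot f g : approximable f -> approximable g ->
  exists d, forall M y e, 0 <= M -> 0 <= e -> bounded_by M f ->
    approximates y e g -> normc (d - f y) <= M * e.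
Proof.
move=> fa ga.
have /choice[s sP] : forall n, exists x, approximates x n.+1%:R^-1 g.
  by move=> n; exact: ga.
have [M0 M00 fM0] := approximable_bounded fa.
have [n m|d dP] := @complex_cvg_rate R (fun n => f (s n)) M0.
  rewrite -approximableB//; apply: (le_trans (fM0 _)); rewrite ler_wpM2l//.
  by apply: approximates_close (sP n) (sP m); exact: ltW.
exists d => M y e M00' e0 fM yg; apply/ler_addgt0Pr => t t0.
have [n nt] : exists n, n.+1%:R^-1 <= t / (M0 + M + 1) :> R.
  by apply: invSn_small; rewrite divr_gt0//; lra.
have -> : d - f y = (d - f (s n)) + f (s n - y).
  by rewrite approximableB//; ring.
apply: (le_trans (normcD _ _)).
have h1 : normc (f (s n - y)) <= M * (n.+1%:R^-1 + e).
  apply: (le_trans (fM _)); rewrite ler_wpM2l//.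
  by apply: approximates_close (sP n) yg => //; exact: ltW.
apply: (le_trans (lerD (dP n) h1)).
move: nt (invSn_gt0 n); rewrite ler_pdivlMr; last lra.
by move: (n.+1%:R^-1) => k; lra.
Qed.

End Approximation.
(** * Completion of a pre-Hilbert space *)

(* The completion of [P] is its isometric copy in the dual: the limits, in the dual
   norm, of the antilinear functionals [pdot x]. Vectors at distance 0 are thereby
   identified without forming a quotient. *)
Record completion (R : realType) (P : preHilbert R) := Completion {
  functional :> P -> R[i];
  functionalP : approximable functional }.

Section CompletionModule.
Variables (R : realType) (P : preHilbert R).
Local Notation H := (completion P).
Implicit Types (f g h : H) (x y z : P) (a : R[i]).

Lemma completion_eq f g : (forall y, f y = g y) -> f = g.
Proof.
case: f g => [f fP] [g gP] /= /funext fg; case: _ / fg in gP *.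
by congr Completion; exact: Prop_irrelevance.
Qed.

HB.instance Definition _ := gen_eqMixin H.
HB.instance Definition _ := gen_choiceMixin H.

Definition completion0 : H := Completion (@approximable0 R P).
Definition completion_lin a f g : H :=
  Completion (approximable_lin a (functionalP f) (functionalP g)).
Definition completion_add f g := completion_lin 1 f g.
Definition completion_opp f := completion_lin (- 1) f completion0.
Definition completion_scale a f := completion_lin a f completion0.

Lemma completion_addA : associative completion_add.
Proof. by move=> f g h; apply: completion_eq => y /=; ring. Qed.
Lemma completion_addC : commutative completion_add.
Proof. by move=> f g; apply: completion_eq => y /=; ring. Qed.
Lemma completion_add0 : left_id completion0 completion_add.
Proof. by move=> f; apply: completion_eq => y /=; ring. Qed.
Lemma completion_addN : left_inverse completion0 completion_opp completion_add.
Proof. by move=> f; apply: completion_eq => y /=; ring. Qed.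

HB.instance Definition _ := GRing.isZmodule.Build H
  completion_addA completion_addC completion_add0 completion_addN.

Lemma functionalD f g y : (f + g) y = f y + g y.
Proof. by rewrite [LHS]/= mul1r. Qed.
Lemma functional0 y : (0 : H) y = 0. Proof. by []. Qed.
Lemma functionalN f y : (- f) y = - f y.
Proof. by rewrite [LHS]/= mulN1r addr0. Qed.

Lemma completion_scaleA a b f :
  completion_scale a (completion_scale b f) = completion_scale (a * b) f.
Proof. by apply: completion_eq => y /=; ring. Qed.
Lemma completion_scale1 : left_id 1 completion_scale.
Proof. by move=> f; apply: completion_eq => y /=; ring. Qed.
Lemma completion_scaleDr : right_distributive completion_scale +%R.
Proof. by move=> a f g; apply: completion_eq => y /=; ring. Qed.
Lemma completion_scaleDl f : {morph completion_scale^~ f : a b / a + b}.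
Proof. by move=> a b; apply: completion_eq => y /=; ring. Qed.

HB.instance Definition _ := GRing.Zmodule_isLmodule.Build R[i] H
  completion_scaleA completion_scale1 completion_scaleDr completion_scaleDl.

Lemma functionalZ a f y : (a *: f) y = a * f y.
Proof. by rewrite [LHS]/= addr0. Qed.

Definition functionalE := (functionalD, functionalN, functionalZ, functional0).

Definition embed x : H := Completion (approximable_pdot x).

Lemma embedE x y : embed x y = pdot x y. Proof. by []. Qed.

Lemma embed_lin a x y : embed (a *: x + y) = a *: embed x + embed y.
Proof. by apply: completion_eq => z; rewrite !functionalE !embedE pdotP. Qed.

Lemma embedB x y : embed (x - y) = embed x - embed y.
Proof. by apply: completion_eq => z; rewrite !functionalE !embedE pdotBl. Qed.

Definition cdot f g : R[i] := sval (cid (ex_dot (functionalP f) (functionalP g))).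

Lemma cdot_approx f g M y e : 0 <= M -> 0 <= e -> bounded_by M f ->
  approximates y e g -> normc (cdot f g - f y) <= M * e.
Proof. by rewrite /cdot; case: cid => d /= h; exact: h. Qed.

Lemma cdot_embed f y : cdot f (embed y) = f y.
Proof.
have [M M0 fM] := approximable_bounded (functionalP f).
apply: (@eq_small _ _ _ 0) => e e0 _; rewrite mul0r.
apply: le_trans (cdot_approx M0 (lexx 0) fM _) _; first exact: approximates_pdot.
by rewrite mulr0.
Qed.

Lemma cdotP a f g h : cdot (a *: f + g) h = a * cdot f h + cdot g h.
Proof.
have [M M0 fM] := approximable_bounded (functionalP f).
have [N N0 gN] := approximable_bounded (functionalP g).
have [L L0 lL] := approximable_bounded (functionalP (a *: f + g)).
apply: (@eq_small _ _ _ (L + normc a * M + N)) => e e0 _.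
have [y yh] := functionalP h e0.
have -> : cdot (a *: f + g) h - (a * cdot f h + cdot g h) =
  (cdot (a *: f + g) h - (a *: f + g) y) +
  (- (a * (cdot f h - f y)) - (cdot g h - g y)).
  by rewrite !functionalE; ring.
have h1 := cdot_approx L0 (ltW e0) lL yh.
have h2 := cdot_approx M0 (ltW e0) fM yh.
have h3 := cdot_approx N0 (ltW e0) gN yh.
apply: (le_trans (normcD _ _)); rewrite -addrA mulrDl lerD//.
apply: (le_trans (normcD _ _)); rewrite !normc_opp normcM mulrDl lerD//.
by rewrite -mulrA ler_wpM2l ?normc_ge0.
Qed.

(** Replacing both arguments by vectors transfers symmetry and positivity from [pdot]. The condition
    [e < 1] turns the bound [N + e] on [pnorm y] into [N + 1]. *)
Lemma cdot_pdot f g M N x y e : 0 <= M -> 0 <= N -> 0 < e -> e < 1 ->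
  bounded_by M f -> bounded_by N g -> approximates x e f -> approximates y e g ->
  normc (cdot f g - pdot x y) <= (M + N + 1) * e.
Proof.
move=> M0 N0 e0 e1 fM gN xf yg.
have h1 := cdot_approx M0 (ltW e0) fM yg.
have h2 := pnorm_approx N0 (ltW e0) gN yg.
have h3 := xf y.
have -> : cdot f g - pdot x y = (cdot f g - f y) + (f y - pdot x y) by ring.
apply: (le_trans (normcD _ _)); apply: (le_trans (lerD h1 h3)).
by rewrite -addrA mulrDl lerD// mulrC ler_wpM2r ?(ltW e0)//; lra.
Qed.

Lemma cdotC f g : cdot g f = (cdot f g)^*.
Proof.
have [M M0 fM] := approximable_bounded (functionalP f).
have [N N0 gN] := approximable_bounded (functionalP g).
apply: (@eq_small _ _ _ ((M + N + 1) + (M + N + 1))) => e e0 e1.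
have [x xf] := functionalP f e0; have [y yg] := functionalP g e0.
have h1 := cdot_pdot M0 N0 e0 e1 fM gN xf yg.
have h2 := cdot_pdot N0 M0 e0 e1 gN fM yg xf.
have -> : cdot g f - (cdot f g)^* =
  (cdot g f - pdot y x) - (cdot f g - pdot x y)^*.
  by rewrite (pdotC x y) rmorphB; ring.
apply: (le_trans (normcD _ _)); rewrite normc_opp normc_conj mulrDl lerD//.
by rewrite (addrC M).
Qed.

Lemma cdot_ge0 f : 0 <= complex.Re (cdot f f).
Proof.
have [M M0 fM] := approximable_bounded (functionalP f).
apply/ler_addgt0Pr => e e0.
(* This precision is below 1, and its product with [M + M + 1] is at most [e]. *)
have d0 : 0 < e / (M + M + 1) / (e + 1) by rewrite !divr_gt0//; lra.
have de : (M + M + 1) * (e / (M + M + 1) / (e + 1)) <= e.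
  by rewrite mulrA [_ * (e / _)]mulrC divfK ?gt_eqF ?ler_pdivrMr; nra.
have d1 : e / (M + M + 1) / (e + 1) < 1.
  by rewrite !ltr_pdivrMr; nra.
have [x xf] := functionalP f d0.
have := le_trans (cdot_pdot M0 M0 d0 d1 fM fM xf xf) de.
move=> /(le_trans (normc_Re _)); rewrite Re_D Re_N ler_norml => /andP[+ _].
have := pdot_ge0 x; lra.
Qed.

Definition completion_preHilbert : preHilbert R := PreHilbert cdotP cdotC cdot_ge0.
Local Notation hn := (@pnorm R completion_preHilbert).

Lemma functional_le f y : normc (f y) <= hn f * pnorm y.
Proof.
rewrite -cdot_embed; apply: le_trans (@cauchy_schwarz _ completion_preHilbert f (embed y)) _.
by rewrite [X in _ * X]/pnorm/= cdot_embed.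
Qed.

Lemma hn_embed x : hn (embed x) = pnorm x.
Proof. by rewrite /pnorm/= cdot_embed. Qed.

(** With [functional_le], this identifies [hn] with the dual norm. For [y] approximating [f] up to
    [t], [cdot f f] is at most [e * t + e * (e + t)], hence at most [(e + t) ^+ 2]. *)
Lemma hn_le f e : 0 <= e -> bounded_by e f -> hn f <= e.
Proof.
move=> e0 fe; apply/ler_addgt0Pr => t t0.
have te : 0 <= e + t by lra.
rewrite -(@ler_pXn2r _ 2) ?nnegrE ?pnorm_ge0// pnorm_sqr/=.
have [y yf] := functionalP f t0.
have h1 := cdot_approx e0 (ltW t0) fe yf.
have h2 := fe y; have h3 := pnorm_approx e0 (ltW t0) fe yf.
have -> : cdot f f = (cdot f f - f y) + f y by ring.
rewrite Re_D; have := le_trans (ler_norm _) (normc_Re (f y)).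
have := le_trans (ler_norm _) (normc_Re (cdot f f - f y)).
have : e * pnorm y <= e * (e + t) by rewrite ler_wpM2l.
nra.
Qed.

Lemma hn_approx f x e : 0 <= e -> approximates x e f -> hn (f - embed x) <= e.
Proof.
by move=> e0 xf; apply: hn_le => // y; rewrite !functionalE embedE; exact: xf.
Qed.

Lemma embed_dense f e : 0 < e -> exists x, hn (f - embed x) <= e.
Proof.
move=> e0; have [x xf] := functionalP f e0.
by exists x; apply: hn_approx => //; exact: ltW.
Qed.

Lemma hn0_eq0 f : hn f = 0 -> f = 0.
Proof.
move=> f0; apply: completion_eq => y; apply: eq0_normc; apply/eqP.
by rewrite eq_le normc_ge0 andbT (le_trans (functional_le f y))// f0 mul0r.
Qed.

Definition cnorm f : R[i] := (hn f)%:C.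

Lemma cnormD f g : cnorm (f + g) <= cnorm f + cnorm g.
Proof. by rewrite /cnorm -rmorphD lecR; exact: (@pnormD _ completion_preHilbert). Qed.

Lemma cnormZ a f : cnorm (a *: f) = `|a| * cnorm f.
Proof.
by rewrite /cnorm (@pnormZ _ completion_preHilbert) normE rmorphM.
Qed.

Lemma cnorm0_eq0 f : cnorm f = 0 -> f = 0.
Proof. by move=> [] /hn0_eq0. Qed.

HB.instance Definition _ := Lmodule_isNormed.Build R[i] H cnormD cnormZ cnorm0_eq0.

Lemma completion_normE f : `|f| = (hn f)%:C. Proof. by []. Qed.

Lemma completion_complete (F : set_system H) :
  ProperFilter F -> cauchy F -> cvg F.
Proof.
move=> FF Fc.
have /choice[p pP] : forall n, exists f, F [set g | hn (f - g) <= n.+1%:R^-1].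
  move=> n; have e0 : (0 : R[i]) < (n.+1%:R^-1 : R)%:C by rewrite ltcR invr_gt0.
  have [f fF] := (cauchyP F).1 Fc _ e0; exists f.
  apply: filterS fF => g; rewrite -ball_normE /ball_/= completion_normE ltcR.
  exact: ltW.
have pn n m : hn (p n - p m) <= n.+1%:R^-1 + m.+1%:R^-1.
  have [g [gn gm]] := filter_ex (filterI (pP n) (pP m)).
  apply: le_trans (@pnorm_triangle _ completion_preHilbert _ g _) _.
  by rewrite lerD// (@pnormBC _ completion_preHilbert).
(* The limit is taken pointwise; since the rate is proportional to [pnorm y], it is a limit in the
   dual norm as well. *)
have /choice[l lP] : forall y, exists l,
    forall n, normc (l - p n y) <= pnorm y * n.+1%:R^-1.
  move=> y; apply: complex_cvg_rate => n m.
  rewrite -functionalN -functionalD; apply: (le_trans (functional_le _ _)).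
  by rewrite mulrC ler_wpM2l ?pnorm_ge0.
have la : approximable l.
  move=> e e0; have [n ne] := invSn_small (divr_gt0 e0 (ltr0n _ 2)).
  have [x xp] := functionalP (p n) (divr_gt0 e0 (ltr0n _ 2)).
  exists x => y; have -> : l y - pdot x y = (l y - p n y) + (p n y - pdot x y) by ring.
  apply: (le_trans (normcD _ _)); rewrite (splitr e) mulrDl lerD//.
  by apply: (le_trans (lP y n)); rewrite mulrC ler_wpM2r ?pnorm_ge0.
pose f : H := Completion la.
have fp n : hn (f - p n) <= n.+1%:R^-1.
  by apply: hn_le => [//|y]; rewrite functionalD functionalN mulrC; exact: lP.
apply/cvg_ex; exists f; apply/cvg_ballP => e e0.
have er : e = (complex.Re e)%:C.
  by case: e e0 => a b; rewrite ltcE /= => /andP[/eqP -> _].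
have r0 : 0 < complex.Re e by rewrite -ltcR -er.
have [n ne] := invSn_small (divr_gt0 r0 (ltr0n _ 3)).
apply: filterS (pP n) => g /= gn.
rewrite -ball_normE /ball_/= completion_normE er ltcR.
apply: le_lt_trans (@pnorm_triangle _ completion_preHilbert _ (p n) _) _.
apply: le_lt_trans (lerD (fp n) gn) _; move: r0 ne; move: (n.+1%:R^-1) => t; lra.
Qed.

HB.instance Definition _ := Uniform_isComplete.Build H completion_complete.

End CompletionModule.

Section CompletionHilbert.
Variables (R : realType) (P : preHilbert R).
Local Notation H := (completion P).
Local Notation CP := (completion_preHilbert P).
Implicit Types (f g h : H) (x y z : P) (a : R[i]).

Lemma cdotBl f g h : cdot (f - g) h = cdot f h - cdot g h.
Proof. exact: (@pdotBl _ CP). Qed.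
Lemma cdotBr f g h : cdot h (f - g) = cdot h f - cdot h g.
Proof. exact: (@pdotBr _ CP). Qed.
Lemma cdotZl a f g : cdot (a *: f) g = a * cdot f g.
Proof. exact: (@pdotZl _ CP). Qed.
Lemma cdotZr a f g : cdot g (a *: f) = a^* * cdot g f.
Proof. exact: (@pdotZr _ CP). Qed.

HB.instance Definition _ := isBilinear.Build R[i] H H R[i] *%R (@Num.conj R[i] \; *%R)
  (@cdot R P) (fun h f g => cdotBl f g h) (fun h f g => cdotBr f g h)
  (fun g a f => cdotZl a f g) (fun g a f => cdotZr a f g).

Lemma cdot_herm (f g : H) : cdot f g = (-1) ^+ false * Num.conj (cdot g f).
Proof. by rewrite expr0 mul1r cdotC. Qed.

HB.instance Definition _ := isHermitianSesquilinear.Build R[i] H false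
  (@Num.conj R[i]) (@cdot R P) cdot_herm.

Lemma cdot_gt0 (f : H) : f != 0 -> 0 < cdot f f.
Proof.
move=> f0; have -> : cdot f f = (pnorm (f : CP) ^+ 2)%:C by exact: (@pdotxxE _ CP).
rewrite ltcR exprn_gt0// lt_def pnorm_ge0 andbT.
by apply: contra_neq f0 => /hn0_eq0.
Qed.

HB.instance Definition _ := isDotProduct.Build R[i] H (@cdot R P) cdot_gt0.

Lemma completion_dotE (f : H) : `|f| ^+ 2 = cdot f f.
Proof.
by rewrite completion_normE -rmorphXn; apply/esym/(@pdotxxE _ CP).
Qed.

Definition completion_hilbert : hilbertType R :=
  @HilbertType R H (@cdot R P) completion_dotE.

End CompletionHilbert.
(** * Extension of operators to the completion *)

Section Extension.
Variables (R : realType) (P : preHilbert R).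
Local Notation H := (completion P).
Local Notation CP := (completion_preHilbert P).
Local Notation hn := (@pnorm R CP).
Implicit Types (f g h : H) (x y z : P) (a : R[i]).

Lemma hnB f g h : hn (f - h) <= hn (f - g) + hn (g - h).
Proof. exact: (@pnorm_triangle _ CP). Qed.

Lemma hnD f g : hn (f + g) <= hn f + hn g.
Proof. exact: (@pnormD _ CP). Qed.

Lemma hnZ a f : hn (a *: f) = normc a * hn f.
Proof. exact: (@pnormZ _ CP). Qed.

Lemma hnN f : hn (- f) = hn f.
Proof. exact: (@pnormN _ CP). Qed.

Lemma hn_ge0 f : 0 <= hn f. Proof. exact: pnorm_ge0. Qed.

Lemma hn_small f K : (forall e, 0 < e -> hn f <= K * e) -> f = 0.
Proof.
move=> h; apply: hn0_eq0; apply/eqP; rewrite eq_le hn_ge0 andbT leNgt.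
apply/negP => f0; have /h : 0 < hn f / (2 * (`|K| + 1)).
  by rewrite divr_gt0// mulr_gt0//; have := normr_ge0 K; lra.
rewrite mulrA ler_pdivlMr; last by have := normr_ge0 K; lra.
have := normr_ge0 K; have := ler_norm K; nra.
Qed.

Lemma embedZ a x : embed (a *: x) = a *: embed x :> H.
Proof. by apply: completion_eq => z; rewrite functionalZ !embedE pdotZl. Qed.

(** Stated with Lipschitz bounds so that it applies directly to compositions, to the identity and to
    [T f - a *: f]. *)
Lemma dense_eq (F G : H -> H) C : 0 <= C ->
  (forall f g, hn (F f - F g) <= C * hn (f - g)) ->
  (forall f g, hn (G f - G g) <= C * hn (f - g)) ->
  (forall x, F (embed x) = G (embed x)) -> F =1 G.
Proof.
move=> C0 FC GC FG f; apply/eqP; rewrite -subr_eq0; apply/eqP.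
apply: (@hn_small _ (C + C)) => e e0; have [x xf] := embed_dense f e0.
apply: (le_trans (hnB _ (F (embed x)) _)); rewrite mulrDl lerD//.
  by apply: (le_trans (FC _ _)); rewrite ler_wpM2l.
rewrite FG -hnN opprB; apply: (le_trans (GC _ _)).
by rewrite ler_wpM2l.
Qed.

Lemma dense_eq0 (F : H -> R[i]) C : 0 <= C ->
  (forall f g, normc (F f - F g) <= C * hn (f - g)) ->
  (forall x, F (embed x) = 0) -> forall f, F f = 0.
Proof.
move=> C0 FC F0 f; apply: (@eq_small _ _ _ C) => e e0 _.
have [x xf] := embed_dense f e0.
by rewrite -(F0 x); apply: (le_trans (FC _ _)); rewrite ler_wpM2l.
Qed.

(** Everything follows from the inequality [SP], which holds for all [x] at once: density gives
    linearity, [f = embed x] gives the value on embedded vectors, and [x = 0] gives the bound. *)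
Lemma ex_extension (A : {linear P -> P}) C : 0 <= C ->
  (forall x, pnorm (A x) <= C * pnorm x) ->
  exists S : {linear H -> H}, (forall x, S (embed x) = embed (A x)) /\
    forall f, hn (S f) <= C * hn f.
Proof.
move=> C0 AC.
have /choice[S SP] : forall f, exists g, forall x,
    hn (g - embed (A x)) <= C * hn (f - embed x).
  move=> f.
  have /choice[s sP] : forall n, exists x, hn (f - embed x) <= n.+1%:R^-1.
    by move=> n; apply: embed_dense; rewrite invr_gt0.
  have /choice[l lP] : forall y, exists l,
      forall n, normc (l - pdot (A (s n)) y) <= C * pnorm y * n.+1%:R^-1.
    move=> y; apply: complex_cvg_rate => n m.
    rewrite -pdotBl -linearB; apply: (le_trans (cauchy_schwarz _ _)).
    rewrite mulrAC ler_wpM2r ?pnorm_ge0//; apply: (le_trans (AC _)).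
    rewrite ler_wpM2l// -hn_embed embedB.
    by apply: (le_trans (hnB _ f _)); rewrite lerD// -hnN opprB.
  have la n : approximates (A (s n)) (C * n.+1%:R^-1) l.
    by move=> y; rewrite mulrAC.
  have ln : approximable l.
    move=> e e0; have [|n ne] := @invSn_small R (e / (C + 1)).
      by rewrite divr_gt0//; lra.
    exists (A (s n)) => y; apply: (le_trans (la n y)); rewrite ler_wpM2r ?pnorm_ge0//.
    move: ne; rewrite ler_pdivlMr; last lra.
    by have := invSn_gt0 R n; move: (n.+1%:R^-1) => t; lra.
  exists (Completion ln) => x; apply/ler_addgt0Pr => e e0.
  have [|n ne] := @invSn_small R (e / (C + C + 1)).
    by rewrite divr_gt0//; lra.
  apply: (le_trans (hnB _ (embed (A (s n))) _)).
  have h1 : hn (Completion ln - embed (A (s n))) <= C * n.+1%:R^-1.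
    by apply: hn_approx => [|y]; [rewrite mulr_ge0|exact: la].
  have h2 : hn (embed (A (s n)) - embed (A x)) <= C * (n.+1%:R^-1 + hn (f - embed x)).
    rewrite -embedB -linearB hn_embed; apply: (le_trans (AC _)).
    rewrite ler_wpM2l// -hn_embed embedB.
    by apply: (le_trans (hnB _ f _)); rewrite lerD// -hnN opprB.
  apply: (le_trans (lerD h1 h2)); move: ne; rewrite ler_pdivlMr; last lra.
  by have := invSn_gt0 R n; move: (n.+1%:R^-1) => t; lra.
have S_lin : linear S.
  move=> a f g; apply/eqP; rewrite -subr_eq0; apply/eqP.
  apply: (@hn_small _ (C * (normc a + 1) + (normc a * C + C))) => e e0.
  have [x xf] := embed_dense f e0; have [y yg] := embed_dense g e0.
  have h1 := SP (a *: f + g) (a *: x + y).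
  have h2 : hn (a *: f + g - embed (a *: x + y)) <= (normc a + 1) * e.
    have -> : a *: f + g - embed (a *: x + y) = a *: (f - embed x) + (g - embed y).
      by rewrite embed_lin scalerBr opprD addrACA.
    apply: (le_trans (hnD _ _)); rewrite hnZ mulrDl mul1r lerD//.
    by rewrite ler_wpM2l ?normc_ge0.
  have -> : S (a *: f + g) - (a *: S f + S g) =
      (S (a *: f + g) - embed (A (a *: x + y))) -
      (a *: (S f - embed (A x)) + (S g - embed (A y))).
    have -> : A (a *: x + y) = a *: A x + A y by exact: linearP.
    rewrite embed_lin scalerBr.
    by rewrite [in RHS]addrACA -opprD opprB addrA subrK.
  apply: (le_trans (hnD _ _)); rewrite hnN mulrDl lerD//.
    by apply: (le_trans h1); rewrite -mulrA ler_wpM2l.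
  apply: (le_trans (hnD _ _)); rewrite hnZ mulrDl lerD// -?mulrA.
    rewrite ler_wpM2l ?normc_ge0//; apply: (le_trans (SP _ _)).
    by rewrite ler_wpM2l.
  by apply: (le_trans (SP _ _)); rewrite ler_wpM2l.
pose S' := GRing.isLinear.Build _ _ _ _ S S_lin.
pose SL : {linear H -> H} := HB.pack S S'.
exists SL; split=> [x|f].
  apply/eqP; rewrite -subr_eq0; apply/eqP/hn0_eq0/eqP.
  rewrite eq_le hn_ge0 andbT; apply: (le_trans (SP (embed x) x)).
  by rewrite subrr (@pnorm0 _ CP) mulr0.
have := SP f 0; rewrite linear0.
have -> : embed (0 : P) = 0 :> H by apply: completion_eq => y; rewrite embedE pdot0l.
by rewrite !subr0.
Qed.

(** The functional [Q] need not attain its infimum on the incomplete space [P]. Near-minimizers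
    suffice: if [Q x] is within [e ^+ 2] of the infimum, then [pdot x] approximates the conjugate of
    [l] up to [e], which is exactly membership in the completion. *)
Lemma riesz (l : P -> R[i]) C : 0 <= C ->
  (forall a x y, l (a *: x + y) = a * l x + l y) ->
  (forall x, normc (l x) <= C * pnorm x) ->
  exists e : H, forall x, cdot (embed x) e = l x.
Proof.
move=> C0 lin lC.
pose Q x := pnorm x ^+ 2 - 2 * complex.Re (l x).
have Qlb x : - C ^+ 2 <= Q x.
  rewrite /Q; have := le_trans (ler_norm _) (normc_Re (l x)).
  have := sqr_ge0 (pnorm x - C); have := lC x; rewrite sqrrB; lra.
have inf_Q : has_inf (range Q).
  by split; [exists (Q 0), 0|exists (- C ^+ 2) => _ [x _ <-]].
have la : approximable (fun y => (l y)^*).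
  move=> e e0; have d0 : 0 < e ^+ 2 by rewrite exprn_gt0.
  have [_ [x _ <-] xQ] := inf_adherent d0 inf_Q.
  exists x => y; set c := (l y)^* - pdot x y.
  rewrite -(@ler_pXn2r _ 2)// ?nnegrE ?normc_ge0 ?mulr_ge0 ?pnorm_ge0 ?(ltW e0)// exprMn.
  apply: discr_le; rewrite ?exprn_ge0 ?normc_ge0 ?pnorm_ge0// => s.
  (* Moving from [x] by [s * c] along [y] changes [Q] by [- 2 * s * |c|^2 + s^2 * |c|^2 * |y|^2];
     near-minimality makes this more than [- e ^+ 2], the input of [discr_le]. *)
  have Qy : inf (range Q) <= Q ((s%:C * c) *: y + x).
    by apply: ge_inf; [case: inf_Q|exists ((s%:C * c) *: y + x)].
  have key (p q : R[i]) : complex.Re ((q^* - p)^* * p) - complex.Re ((q^* - p) * q)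
      = - normc (q^* - p) ^+ 2.
    by rewrite normc_sqr; case: p => p1 p2; case: q => q1 q2 /=; ring.
  have QE : Q ((s%:C * c) *: y + x) =
      Q x - 2 * s * normc c ^+ 2 + s ^+ 2 * normc c ^+ 2 * pnorm y ^+ 2.
    rewrite /Q lin Re_D (addrC _ x) pnorm_sqrD pdotZr pnormZ normcM normc_real.
    rewrite conjMr -!(mulrA s%:C) !Re_Mr !exprMn real_normK ?num_real//.
    have := key (pdot x y) (l y); rewrite -/c => h.
    have -> : complex.Re (c^* * pdot x y) = complex.Re (c * l y) - normc c ^+ 2 by lra.
    ring.
  move: (lt_le_trans xQ (lerD Qy (lexx (e ^+ 2)))); rewrite QE; lra.
exists (Completion la) => x.
by rewrite (cdotC (Completion la)) cdot_embed /= conjCK.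
Qed.

End Extension.

(** * Operator norms on the completion *)

Section OperatorNorm.
Variables (R : realType) (P : preHilbert R).
Local Notation H := (completion_hilbert P).
Local Notation hn := (@pnorm R (completion_preHilbert P)).
Implicit Types (f g : H).

Lemma le1_hn f : (`|f| <= 1) = (hn f <= 1).
Proof. by rewrite -lecR. Qed.

Lemma opnorm_le (F : H -> H) C : 0 <= C ->
  (forall f, hn (F f) <= C * hn f) -> opnorm F <= C.
Proof.
move=> C0 FC; apply: ge_sup.
  by exists (complex.Re `|F 0|), 0 => //=; rewrite normr0 ler01.
move=> _ [f /= f1 <-]; apply: (le_trans (FC f)).
by rewrite ler_piMr// -le1_hn.
Qed.

(** The bound [C] ensures that [sup] is a genuine supremum and not its default value; homogeneity
    then reduces to unit vectors. *)
Lemma hn_le_opnorm (F : H -> H) C : 0 <= C ->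
  (forall a f, F (a *: f) = a *: F f) ->
  (forall f, hn (F f) <= C * hn f) -> forall f, hn (F f) <= opnorm F * hn f.
Proof.
move=> C0 FZ FC f; have := hn_ge0 f; rewrite le_eqVlt => /predU1P[f0|f0].
  by apply: (le_trans (FC f)); rewrite -f0 !mulr0.
rewrite -ler_pdivrMr//.
pose g : H := ((hn f)^-1)%:C *: f.
have gE (c : R) : 0 < c -> normc ((c^-1)%:C) = c^-1.
  by move=> c0; rewrite normc_real ger0_norm// invr_ge0 ltW.
have g1 : hn g = 1 by rewrite /g hnZ gE// mulVf// gt_eqF.
have -> : hn (F f) / hn f = complex.Re `|F g|.
  by rewrite /g FZ [RHS](hnZ _ (F f)) gE// mulrC.
apply: ub_le_sup; last by exists g => //=; rewrite le1_hn g1.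
exists C => _ [h /= h1 <-]; apply: (le_trans (FC h)).
by rewrite ler_piMr// -le1_hn.
Qed.

Lemma bounded_operator_hn (F : H -> H) C :
  (forall f, hn (F f) <= C * hn f) -> bounded_operator F.
Proof.
move=> FC; exists C => f.
by rewrite -[`|F f|]/((hn (F f))%:C) -[`|f|]/((hn f)%:C) -rmorphM lecR.
Qed.

End OperatorNorm.

(** * From a rank-one defect on a pre-Hilbert space to an operator on a Hilbert space *)

Section RankOneDefect.
Variables (R : realType) (P : preHilbert R) (E : set R[i]).
Variables (A Ai : {linear P -> P}) (l : P -> R[i]) (K : nat -> R).
Hypothesis l_lin : forall a x y, l (a *: x + y) = a * l x + l y.
Hypothesis A_defect : forall x y, pdot (A x) (A y) = pdot x y - l x * (l y)^*.
Hypothesis AK : cancel A Ai.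
Hypothesis AiK : cancel Ai A.
Hypothesis K_ge0 : forall n, 0 <= K n.
Hypothesis Ai_bound : forall n x, pnorm (iter n Ai x) <= K n * pnorm x.
Hypothesis A_resolvent : forall a, ~ E a -> exists (S : {linear P -> P}) (C : R),
  [/\ 0 <= C, forall x, pnorm (S x) <= C * pnorm x,
      forall x, S (A x - a *: x) = x & forall x, A (S x) - a *: S x = x].
Hypothesis l_neq0 : exists x, l x != 0.
Hypothesis Ai_unbounded : forall C, exists n x, (1 <= n)%N /\
  C * pnorm x < pnorm (iter n Ai x).

Local Notation H := (completion_hilbert P).
Local Notation CP := (completion_preHilbert P).
Local Notation hn := (@pnorm R CP).

(** Positivity of either term of [|A x|^2 + |l x|^2 = |x|^2] bounds the other: [A] is a contraction,
    and [l] is bounded, so that [riesz] applies to it. *)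
Lemma A_normE x : pnorm (A x) ^+ 2 = pnorm x ^+ 2 - normc (l x) ^+ 2.
Proof. by rewrite !pnorm_sqr A_defect Re_D Re_N -normc_sqr. Qed.

Lemma A_contraction x : pnorm (A x) <= 1 * pnorm x.
Proof.
rewrite mul1r -(@ler_pXn2r _ 2)// ?nnegrE ?pnorm_ge0// A_normE.
by have := sqr_ge0 (normc (l x)); lra.
Qed.

Lemma l_bounded x : normc (l x) <= 1 * pnorm x.
Proof.
rewrite mul1r -(@ler_pXn2r _ 2)// ?nnegrE ?pnorm_ge0 ?normc_ge0//.
by have := sqr_ge0 (pnorm (A x)); rewrite A_normE; lra.
Qed.

Lemma lip_of_bound (F : {linear H -> H}) C : (forall f, hn (F f) <= C * hn f) ->
  forall f g, hn (F f - F g) <= C * hn (f - g).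
Proof. by move=> FC f g; rewrite -linearB. Qed.

Lemma rank_one_defect_model :
  exists (H : hilbertType R) (T : {linear H -> H}),
    [/\ bounded_operator T, opnorm T <= 1, spectrum T `<=` E &
    exists Tinv Tstar : {linear H -> H},
      [/\ inverse_operator T Tinv,
          adjoint_operator T Tstar,
          forall n, opnorm (iter n Tinv) <= K n,
          has_rank (fun x => x - Tstar (T x)) 1 &
          ereal_sup [set (opnorm (iter n Tinv))%:E | n in [set n | (1 <= n)%N]]
            = +oo%E]].
Proof.
have [T [TE TC]] := ex_extension ler01 A_contraction.
have [S [SE SC]] := ex_extension (K_ge0 1) (Ai_bound 1).
have [e eP] := riesz ler01 l_lin l_bounded.
have idL (C : R) (f g : H) : 1 <= C -> hn (f - g) <= C * hn (f - g).
  by move=> C1; rewrite ler_peMl ?hn_ge0.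
have iterB n (f g : H) : iter n S f - iter n S g = iter n S (f - g).
  by elim: n => //= n <-; rewrite linearB.
have iterZ n a (f : H) : iter n S (a *: f) = a *: iter n S f.
  by elim: n => //= n ->; rewrite linearZ.
have iterE n x : iter n S (embed x) = embed (iter n Ai x).
  by elim: n => //= n ->; rewrite SE.
have iter_le n f : hn (iter n S f) <= K n * hn f.
  (* The crude bound [K 1 ^+ m] is only applied to the small vector [f - embed x]; the sharp [K n]
     acts on the dense part. *)
  have iter_le0 m h : hn (iter m S h) <= K 1 ^+ m * hn h.
    elim: m => [|m IH] /=; first by rewrite expr0 mul1r.
    by apply: (le_trans (SC _)); rewrite exprS -mulrA ler_wpM2l.
  apply/ler_addgt0Pr => d d0; have K1n := exprn_ge0 n (K_ge0 1).
  have [|x xf] := embed_dense f (e := d / (K 1 ^+ n + K n + 1)).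
    by rewrite divr_gt0//; have := K_ge0 n; lra.
  have -> : iter n S f = iter n S (f - embed x) + embed (iter n Ai x).
    by rewrite -iterB iterE subrK.
  apply: (le_trans (hnD _ _)); rewrite hn_embed.
  apply: (le_trans (lerD (iter_le0 _ _) (Ai_bound _ _))).
  have : pnorm x <= hn f + hn (f - embed x).
    by rewrite -hn_embed -{1}(subKr f (embed x)); apply: (le_trans (hnD _ _)); rewrite hnN.
  move: xf; rewrite ler_pdivlMr; last by have := K_ge0 n; lra.
  have := K_ge0 n; have := hn_ge0 (f - embed x).
  move: K1n; move: (K 1 ^+ n) (K n) (hn _) (hn _) (pnorm x) => u v p q r.
  nra.
(* The Lipschitz constant [K 1 + 1] serves both the composition and the identity. *)
have TS : forall f, T (S f) = f.
  apply: (@dense_eq _ _ _ _ (K 1 + 1)); first by have := K_ge0 1; lra.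
  - move=> f g; apply: (le_trans (lip_of_bound TC _ _)); rewrite mul1r.
    apply: (le_trans (lip_of_bound SC _ _)); rewrite ler_wpM2r ?hn_ge0//; lra.
  - by move=> f g; apply: idL; have := K_ge0 1; lra.
  - by move=> x; rewrite SE TE AiK.
have ST : forall f, S (T f) = f.
  apply: (@dense_eq _ _ _ _ (K 1 + 1)); first by have := K_ge0 1; lra.
  - move=> f g; apply: (le_trans (lip_of_bound SC _ _)).
    apply: ler_pM => //; rewrite ?hn_ge0//; first lra.
    by have := lip_of_bound TC f g; rewrite mul1r.
  - by move=> f g; apply: idL; have := K_ge0 1; lra.
  - by move=> x; rewrite TE SE AK.
have CS (f g : H) : normc (cdot f g) <= hn f * hn g by exact: (@cauchy_schwarz _ CP).
have defect : forall f g, cdot (T f) (T g) = cdot f g - cdot f e * (cdot g e)^*.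
  (* The error of the identity is a bounded sesquilinear form vanishing on embedded vectors. Density
     removes the restriction on one argument, Hermitian symmetry [FC] on the other. *)
  pose F (f g : H) := cdot (T f) (T g) - (cdot f g - cdot f e * (cdot g e)^*).
  suff F0 : forall f g, F f g = 0 by move=> f g; apply/eqP; rewrite -subr_eq0; apply/eqP/F0.
  have FB (f f' g : H) : F f g - F f' g = F (f - f') g.
    rewrite /F [T (f - f')]linearB !cdotBl; ring.
  have FC (f g : H) : F g f = (F f g)^*.
    rewrite /F !conjB conjM conjCK (cdotC (T f)) (cdotC f g); ring.
  have F_le (f g : H) : normc (F f g) <= (2 + hn e * hn e) * hn g * hn f.
    apply: (le_trans (normcD _ _)); rewrite normc_opp.
    have := normcD (cdot f g) (- (cdot f e * (cdot g e)^*)).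
    rewrite normc_opp normcM normc_conj.
    have h1 := CS f g; have h2 := CS (T f) (T g).
    have h3 : hn (T f) * hn (T g) <= hn f * hn g.
      by apply: ler_pM; rewrite ?hn_ge0//; rewrite -[leRHS]mul1r; exact: TC.
    have h4 : normc (cdot f e) * normc (cdot g e) <= hn f * hn e * (hn g * hn e).
      by apply: ler_pM; rewrite ?normc_ge0.
    move=> h5; move: h1 h2 h3 h4 h5.
    move: (hn f) (hn g) (hn e) (normc (cdot f e) * _) => p q r w; nra.
  have hg g : 0 <= (2 + hn e * hn e) * hn g.
    by rewrite mulr_ge0 ?hn_ge0// addr_ge0// mulr_ge0 ?hn_ge0.
  have F1 f y : F f (embed y) = 0.
    apply: (@dense_eq0 _ _ (fun f => F f (embed y)) _ (hg (embed y))) => [f' g|x].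
      by rewrite FB; exact: F_le.
    rewrite /F !TE !eP !cdot_embed /= A_defect; ring.
  move=> f g; rewrite FC; apply/eqP; rewrite conjC_eq0; apply/eqP.
  apply: (@dense_eq0 _ _ (fun g => F g f) _ (hg f)) => [g' h|x].
    by rewrite FB; exact: F_le.
  by rewrite FC F1 conjC0.
(* The defect identity reads [T^* T = I - <., e> e]; composing with [S], the inverse of [T], on the
   right gives this formula for the adjoint. *)
pose Sstar (f : H) : H := S f - cdot (S f) e *: e.
have Sstar_lin : linear Sstar.
  move=> a f g; rewrite /Sstar linearP cdotP scalerDl -scalerA scalerBr.
  by rewrite opprD addrACA.
pose Ts : {linear H -> H} := HB.pack Sstar (GRing.isLinear.Build _ _ _ _ Sstar Sstar_lin).
exists H, T; split.
- exact: bounded_operator_hn TC.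
- exact: opnorm_le TC.
- move=> a ha; apply: contrapT => /A_resolvent [S' [C [C0 S'C S'A AS']]]; apply: ha.
  have [U [UE UC]] := ex_extension C0 S'C.
  have na := normc_ge0 a.
  have TaC f : hn (T f - a *: f) <= (1 + normc a) * hn f.
    apply: (le_trans (hnD _ _)); rewrite hnN hnZ mulrDl lerD//; exact: TC.
  have TaB f g : (T f - a *: f) - (T g - a *: g) = T (f - g) - a *: (f - g).
    by rewrite [T (f - g)]linearB scalerBr !opprD !opprK addrACA.
  have D0 : 0 <= (1 + normc a) * C + 1 by have := mulr_ge0 na C0; lra.
  have D1 : 1 <= (1 + normc a) * C + 1 by have := mulr_ge0 na C0; lra.
  have DB f : (1 + normc a) * C * hn f <= ((1 + normc a) * C + 1) * hn f.
    by rewrite ler_wpM2r ?hn_ge0//; lra.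
  exists U; split; first exact: bounded_operator_hn UC.
  + apply: (dense_eq D0) => [f g|f g|x].
    * rewrite -linearB TaB; apply: (le_trans (UC _)); apply: le_trans (DB _).
      by rewrite mulrAC [leRHS]mulrC ler_wpM2l.
    * exact: idL.
    * by rewrite TE -embedZ -embedB UE S'A.
  + apply: (dense_eq D0) => [f g|f g|x].
    * rewrite TaB; apply: (le_trans (TaC _)); apply: le_trans (DB _).
      by rewrite -mulrA ler_wpM2l -?linearB//; lra.
    * exact: idL.
    * by rewrite UE TE -embedZ -embedB AS'.
exists S, Ts; split.
- by split=> //; exact: bounded_operator_hn SC.
- split.
    apply: (@bounded_operator_hn _ _ _ (K 1 + K 1 * hn e * hn e)) => f.
    apply: (le_trans (hnD _ _)); rewrite hnN hnZ mulrDl lerD//.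
    apply: (@le_trans _ _ (hn (S f) * hn e * hn e)).
      by rewrite ler_wpM2r ?hn_ge0//; exact: CS.
    rewrite -!mulrA mulrC [leRHS]mulrC -!mulrA ler_wpM2l ?hn_ge0//.
    rewrite ler_wpM2l ?hn_ge0// [leRHS]mulrC; exact: SC.
  move=> f g; rewrite [RHS]cdotBr cdotZr.
  by rewrite -{1}(TS g) [LHS]defect mulrC.
- by move=> n; exact: opnorm_le.
- have e0 : e != 0.
    by have [x] := l_neq0; apply: contra_neq => e0; rewrite -eP e0 (cdotC 0) cdot_embed rmorph0.
  have ee0 : cdot e e != 0 by rewrite gt_eqF// cdot_gt0.
  exists (fun=> e); split.
    move=> c; rewrite big_ord1 => /eqP; rewrite scaler_eq0 (negPf e0) orbF => /eqP c0 i.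
    by rewrite (ord1 i).
  apply/seteqP; split=> [_ [f _ <-]|_ [c _ <-]].
    exists (fun=> cdot f e) => //; rewrite big_ord1.
    by rewrite /Ts /= /Sstar ST subKr.
  exists ((c ord0 / cdot e e) *: e) => //.
  rewrite big_ord1 /Ts /= /Sstar ST subKr.
  by congr (_ *: _); rewrite cdotZl divfK.
- apply/eqyP => C C0; have [n [x [n1 xC]]] := Ai_unbounded C.
  have x0 : 0 < pnorm x.
    rewrite lt_def pnorm_ge0 andbT; apply: contraTneq xC => x0.
    by rewrite x0 mulr0 -leNgt (le_trans (Ai_bound n x))// x0 mulr0.
  apply: le_ereal_sup_tmp; exists (@opnorm R H (iter n S))%:E; first by exists n.
  rewrite lee_fin -(ler_pM2r x0) ltW//; apply: (lt_le_trans xC).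
  rewrite -[pnorm (iter _ _ _)]hn_embed -iterE -[pnorm x in leRHS]hn_embed.
  exact: (hn_le_opnorm (K_ge0 n)).
Qed.

End RankOneDefect.
(** * Integration of bounded measurable functions *)

Section BoundedMeasurable.
Variable R : realType.
Local Notation mu := (@lebesgue_measure R).
Local Notation D := (`[0, 2 * pi]%classic : set R).
Implicit Types (f g : R -> R[i]) (r s : R -> R).

(** Bounds hold everywhere, not almost everywhere: the class is stable under products and each
    member is integrable on [D]. *)
Definition bmr r := measurable_fun setT r /\ exists M, forall t, `|r t| <= M.

Lemma bmr_cst c : bmr (cst c).
Proof. by split=> //; exists `|c|. Qed.

Lemma bmrD r s : bmr r -> bmr s -> bmr (fun t => r t + s t).
Proof.
move=> [mr [M rM]] [ms [N sN]]; split; first exact: measurable_funD.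
by exists (M + N) => t; rewrite (le_trans (ler_normD _ _))// lerD.
Qed.

Lemma bmrM r s : bmr r -> bmr s -> bmr (fun t => r t * s t).
Proof.
move=> [mr [M rM]] [ms [N sN]]; split; first exact: measurable_funM.
by exists (M * N) => t; rewrite normrM ler_pM.
Qed.

Lemma bmrN r : bmr r -> bmr (fun t => - r t).
Proof.
by move=> /(bmrM (bmr_cst (- 1))); under eq_fun do rewrite mulN1r.
Qed.

Lemma bmr_indic A : measurable A -> bmr (\1_A : R -> R).
Proof.
move=> mA; split; first exact: measurable_indic.
by exists 1 => t; rewrite indicE; case: (_ \in _); rewrite ?normr1 ?normr0.
Qed.

Lemma bmr_continuous r M : continuous r -> (forall t, `|r t| <= M) -> bmr r.
Proof. by move=> cr rM; split; [exact: continuous_measurable_fun|exists M]. Qed.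

Lemma measurable_D : measurable D. Proof. exact: measurable_itv. Qed.

Lemma mu_D : mu D = (2 * pi)%:E.
Proof.
by rewrite lebesgue_measure_itv /= lte_fin mulr_gt0 ?pi_gt0// sube0.
Qed.

Lemma bmr_integrable r : bmr r -> mu.-integrable D (EFin \o r).
Proof.
move=> [mr [M rM]]; apply: measurable_bounded_integrable.
- exact: measurable_D.
- by rewrite [X in (X < _)%E]mu_D ltry.
- exact: measurable_funTS.
- exists M; split; first exact: num_real.
  by move=> N MN t _ /=; apply: le_trans (ltW MN).
Qed.

Definition rint r : R := \int[mu]_(t in D) r t.

Lemma rintD r s : bmr r -> bmr s -> rint (fun t => r t + s t) = rint r + rint s.
Proof. by move=> br bs; apply: RintegralD; rewrite //; exact: bmr_integrable. Qed.

Lemma rintZ c r : bmr r -> rint (fun t => c * r t) = c * rint r.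
Proof. by move=> br; apply: RintegralZl; rewrite //; exact: bmr_integrable. Qed.

Lemma rintN r : bmr r -> rint (fun t => - r t) = - rint r.
Proof.
move=> br; rewrite -mulN1r -rintZ//; by under eq_fun do rewrite -mulN1r.
Qed.

Lemma le_rint r s : bmr r -> bmr s -> (forall t, r t <= s t) -> rint r <= rint s.
Proof.
by move=> br bs rs; apply: le_Rintegral; rewrite //; exact: bmr_integrable.
Qed.

Lemma rint_ge0 r : (forall t, 0 <= r t) -> 0 <= rint r.
Proof. by move=> r0; apply: Rintegral_ge0. Qed.

Lemma rint_cst c : rint (cst c) = 2 * pi * c.
Proof.
by rewrite /rint Rintegral_cst; [rewrite [X in fine X]mu_D mulrC|exact: measurable_D].
Qed.

Lemma rint_indic A : measurable A -> A `<=` D -> (rint \1_A)%:E = mu A.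
Proof.
move=> mA AD; have := integral_indic mu measurable_D mA; rewrite setIidl// => h.
rewrite /rint /Rintegral [X in fine X]h.
rewrite fineK// ge0_fin_numE//; apply: (@le_lt_trans _ _ (mu D)).
  by apply: le_measure; rewrite ?inE//; exact: measurable_D.
by rewrite [X in (X < _)%E]mu_D ltry.
Qed.

Definition bmf f :=
  bmr (fun t => complex.Re (f t)) /\ bmr (fun t => complex.Im (f t)).

Definition cint f : R[i] :=
  rint (fun t => complex.Re (f t)) +i* rint (fun t => complex.Im (f t)).

Lemma bmf_real r : bmr r -> bmf (fun t => (r t)%:C).
Proof. by move=> br; split=> //=; exact: bmr_cst. Qed.

Lemma bmf_cst (c : R[i]) : bmf (fun=> c).
Proof. by split; exact: bmr_cst. Qed.

Lemma Im_D (a b : R[i]) : complex.Im (a + b) = complex.Im a + complex.Im b.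
Proof. by case: a; case: b. Qed.
Lemma Re_M (a b : R[i]) : complex.Re (a * b) =
  complex.Re a * complex.Re b - complex.Im a * complex.Im b.
Proof. by case: a; case: b. Qed.
Lemma Im_M (a b : R[i]) : complex.Im (a * b) =
  complex.Re a * complex.Im b + complex.Im a * complex.Re b.
Proof. by case: a; case: b. Qed.
Lemma Im_conj (a : R[i]) : complex.Im (a^*) = - complex.Im a.
Proof. by case: a. Qed.

Lemma bmfD f g : bmf f -> bmf g -> bmf (fun t => f t + g t).
Proof.
move=> [f1 f2] [g1 g2]; split.
  by under eq_fun do rewrite Re_D; exact: bmrD.
by under eq_fun do rewrite Im_D; exact: bmrD.
Qed.

Lemma bmfM f g : bmf f -> bmf g -> bmf (fun t => f t * g t).
Proof.
move=> [f1 f2] [g1 g2]; split.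
  by under eq_fun do rewrite Re_M; apply: bmrD; [|apply: bmrN]; exact: bmrM.
by under eq_fun do rewrite Im_M; apply: bmrD; exact: bmrM.
Qed.

Lemma bmf_conj f : bmf f -> bmf (fun t => (f t)^*).
Proof.
move=> [f1 f2]; split.
  by under eq_fun do rewrite Re_conj.
by under eq_fun do rewrite Im_conj; exact: bmrN.
Qed.

Lemma bmfZ c f : bmf f -> bmf (fun t => c * f t).
Proof. by apply: bmfM; exact: bmf_cst. Qed.

Lemma bmf_sum n (F : nat -> R -> R[i]) : (forall k, bmf (F k)) ->
  bmf (fun t => \sum_(k < n) F k t).
Proof.
move=> bF; elim: n => [|n IH]; first by under eq_fun do rewrite big_ord0; exact: bmf_cst.
by under eq_fun do rewrite big_ord_recr; apply: bmfD.
Qed.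

Lemma bmr_normc2 f : bmf f -> bmr (fun t => normc (f t) ^+ 2).
Proof.
move=> bf; under eq_fun do rewrite normc_sqr.
exact: (bmfM bf (bmf_conj bf)).1.
Qed.

Lemma cintD f g : bmf f -> bmf g -> cint (fun t => f t + g t) = cint f + cint g.
Proof.
move=> [f1 f2] [g1 g2]; rewrite /cint; under eq_fun do rewrite Re_D.
by under [X in _ +i* rint X]eq_fun do rewrite Im_D; rewrite !rintD.
Qed.

Lemma cintZ c f : bmf f -> cint (fun t => c * f t) = c * cint f.
Proof.
move=> [f1 f2]; rewrite /cint; under eq_fun do rewrite Re_M.
under [X in _ +i* rint X]eq_fun do rewrite Im_M.
have c1 := bmr_cst (complex.Re c); have c2 := bmr_cst (complex.Im c).
have h1 := bmrM c1 f1; have h2 := bmrM c1 f2.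
have h3 := bmrM c2 f1; have h4 := bmrM c2 f2.
rewrite rintD//; last exact: bmrN.
rewrite rintN// rintD// !rintZ//.
by case: c {c1 c2 h1 h2 h3 h4} => a b /=; simpc.
Qed.

Lemma cint_conj f : bmf f -> cint (fun t => (f t)^*) = (cint f)^*.
Proof.
move=> [f1 f2]; rewrite /cint; under eq_fun do rewrite Re_conj.
by under [X in _ +i* rint X]eq_fun do rewrite Im_conj; rewrite rintN.
Qed.

Lemma cint_real r : cint (fun t => (r t)%:C) = (rint r)%:C.
Proof.
by rewrite /cint /=; congr Complex; rewrite -[RHS](mulr0 (2 * pi)) -rint_cst.
Qed.

Lemma cint_sum n (F : nat -> R -> R[i]) : (forall k, bmf (F k)) ->
  cint (fun t => \sum_(k < n) F k t) = \sum_(k < n) cint (F k).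
Proof.
move=> bF; elim: n => [|n IH].
  under eq_fun do rewrite big_ord0; rewrite big_ord0.
  by rewrite (_ : 0 = (0 : R)%:C)// cint_real (rint_cst 0) mulr0.
rewrite big_ord_recr -IH; under eq_fun do rewrite big_ord_recr.
by rewrite cintD//; exact: bmf_sum.
Qed.

(** Asking that [v] invert [w] only where [f] is nonzero allows [v] to be a bounded truncation of
    [1 / w]. With [c] the integral of [f * g], integrating [2 s Re(c^* f g) <= w |f|^2 + s^2 |c|^2 v
    |g|^2] gives the hypothesis of [discr_le]. *)
Lemma cint_cauchy_schwarz (w v : R -> R) f g :
  bmr w -> (forall t, 0 <= w t) -> bmr v -> (forall t, 0 <= v t) ->
  bmf f -> bmf g -> (forall t, f t != 0 -> w t * v t = 1) ->
  normc (cint (fun t => f t * g t)) ^+ 2 <=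
  rint (fun t => w t * normc (f t) ^+ 2) * rint (fun t => v t * normc (g t) ^+ 2).
Proof.
move=> bw w0 bv v0 bf bg wv.
apply: discr_le; rewrite ?exprn_ge0 ?normc_ge0//.
  by apply: rint_ge0 => t; rewrite mulr_ge0// exprn_ge0 ?normc_ge0.
move=> s; set c := cint _.
have bfg := bmfM bf bg.
have b1 := bmrM bw (bmr_normc2 bf); have b2 := bmrM bv (bmr_normc2 bg).
have Rec : normc c ^+ 2 = rint (fun t => complex.Re (c^* * (f t * g t))).
  by rewrite normc_sqr mulrC -cintZ.
have b3 : bmr (fun t => complex.Re (c^* * (f t * g t))) by case: (bmfZ c^* bfg).
have b4 := bmrM (bmr_cst (s ^+ 2 * normc c ^+ 2)) b2.
rewrite {1}Rec -[leLHS]rintZ// -[X in _ <= X + _]rintZ// addrC -rintD//.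
apply: le_rint => [||t].
- exact: (bmrM (bmr_cst _) b3).
- exact: bmrD.
have [f0|f0] := eqVneq (f t) 0.
  have z2 : (0 : R) ^+ 2 = 0 by rewrite expr0n.
  rewrite f0 mul0r mulr0 normc0 z2 [complex.Re 0]/= !mulr0 ?add0r ?addr0.
  exact: (mulr_ge0 (mulr_ge0 (sqr_ge0 _) (sqr_ge0 _)) (mulr_ge0 (v0 t) (sqr_ge0 _))).
have vt : 0 < v t.
  rewrite lt_def v0 andbT; apply/negP => /eqP vt0.
  by have /eqP := wv _ f0; rewrite vt0 mulr0 eq_sym oner_eq0.
have -> : w t = (v t)^-1 by rewrite -[LHS](mulfK (lt0r_neq0 vt)) wv// mul1r.
rewrite -(ler_pM2l vt) mulrDr (mulrA (v t) (v t)^-1) mulfV ?lt0r_neq0// mul1r.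
have h1 : `|complex.Re (c^* * (f t * g t))| <= normc c * normc (f t) * normc (g t).
  by apply: (le_trans (normc_Re _)); rewrite !normcM normc_conj mulrA.
move: h1; set q := complex.Re _; move: (normc c) (normc (f t)) (normc (g t)) => x y z.
rewrite ler_norml => /andP[h1 h2].
have -> : v t * (s ^+ 2 * x ^+ 2 * (v t * z ^+ 2)) = (s * v t * x * z) ^+ 2 by ring.
have := sqr_ge0 (y - s * v t * x * z); have := sqr_ge0 (y + s * v t * x * z).
rewrite sqrrB sqrrD; have [s0|s0] := leP 0 s.
  have : v t * s * q <= v t * s * (x * y * z) by rewrite ler_wpM2l ?mulr_ge0.
  lra.
have : v t * s * q <= v t * s * - (x * y * z).
  by rewrite ler_wnM2l// nmulr_lle0// ltW.
lra.
Qed.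

End BoundedMeasurable.

(** * Characters, Parseval's identity and duality for coefficients *)

Section TrigonometricPolynomials.
Variable R : realType.
Local Notation mu := (@lebesgue_measure R).
Local Notation D := (`[0, 2 * pi]%classic : set R).
Implicit Types (k m : int) (t : R).

Definition cexp k t : R[i] := cos (k%:~R * t) +i* sin (k%:~R * t).

Lemma cexpD k m t : cexp (k + m) t = cexp k t * cexp m t.
Proof.
rewrite /cexp intrD mulrDl cosD sinD; apply/eqP; rewrite eq_complex /=.
by rewrite eqxx /= addrC mulrC [X in _ + X]mulrC addrC mulrC eqxx.
Qed.

Lemma cexp0 t : cexp 0 t = 1.
Proof. by rewrite /cexp mul0r cos0 sin0. Qed.

Lemma cexpN k t : cexp (- k) t = (cexp k t)^*.
Proof. by rewrite /cexp intrN mulNr cosN sinN. Qed.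

Lemma normc_cexp k t : normc (cexp k t) = 1.
Proof. by rewrite /cexp /= cos2Dsin2 sqrtr1. Qed.

Lemma cexpNK k t : cexp (- k) t * cexp k t = 1.
Proof. by rewrite -cexpD addNr cexp0. Qed.

Lemma continuous_cos_mul (c : R) : continuous (fun t => cos (c * t)).
Proof.
move=> t; apply: continuous_comp; last exact: continuous_cos.
exact: mulrl_continuous.
Qed.

Lemma continuous_sin_mul (c : R) : continuous (fun t => sin (c * t)).
Proof.
move=> t; apply: continuous_comp; last exact: continuous_sin.
exact: mulrl_continuous.
Qed.

Lemma bmf_cexp k : bmf (cexp k).
Proof.
split; apply: (@bmr_continuous _ _ 1); rewrite /=.
- exact: continuous_cos_mul.
- by move=> t; rewrite ler_norml cos_geN1 cos_le1.
- exact: continuous_sin_mul.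
- by move=> t; rewrite ler_norml sin_geN1 sin_le1.
Qed.

Lemma cexp_nat (n : nat) t : cexp n t = cexp 1 t ^+ n.
Proof.
elim: n => [|n IH]; first by rewrite cexp0 expr0.
by rewrite -addn1 PoszD cexpD IH exprD expr1.
Qed.

Lemma cexp_2pi k : cexp k (2 * pi) = 1.
Proof.
have c1 : cexp 1 (2 * pi) = 1 :> R[i].
  by rewrite /cexp mul1r mulr_natl cos2pi sin2pi.
have cn (n : nat) : cexp n (2 * pi) = 1 :> R[i] by rewrite cexp_nat c1 expr1n.
by case: k => n //; rewrite NegzE cexpN cn conjC1.
Qed.

Lemma rint_FTC (f F : R -> R) : continuous f ->
  (forall t, is_derive t 1 F (f t)) -> rint f = F (2 * pi) - F 0.
Proof.
move=> cf dF; rewrite /rint /Rintegral.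
have Fc : continuous F.
  by move=> t; apply: differentiable_continuous; apply/derivable1_diffP; case: (dF t).
rewrite (@continuous_FTC2 _ f F); first by [].
- by rewrite mulr_gt0 ?pi_gt0.
- exact: continuous_subspaceT.
- split; first by move=> t _; case: (dF t).
  + by apply: cvg_at_right_filter; exact: Fc.
  + by apply: cvg_at_left_filter; exact: Fc.
- by move=> t _; rewrite derive1E; case: (dF t).
Qed.

Lemma is_derive_mull (c t : R) : is_derive t 1 (fun x => c * x) c.
Proof.
have h : is_derive t 1 (c \*: (@id R)) (c *: (1 : R)) by exact: is_deriveZ.
by move: h; rewrite [_ *: 1]mulr1.
Qed.

Lemma cint_cexp k : k != 0 -> cint (cexp k) = 0.
Proof.
move=> k0; have : (k%:~R : R) != 0 by rewrite intr_eq0.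
have := cexp_2pi k; rewrite /cexp /cint; move: (k%:~R : R) => c [c2pi s2pi] c0.
have dsin t : is_derive t 1 (fun x => c^-1 * sin (c * x)) (cos (c * t)).
  have h1 := is_derive1_comp (is_derive_sin (c * t)) (is_derive_mull c t).
  have h2 : is_derive t 1 (c^-1 \*: (sin \o (fun x => c * x))) (c^-1 *: (cos (c * t) * c)).
    exact: is_deriveZ.
  by move: h2; rewrite [_ *: _](mulrC c^-1) mulfK.
have dcos t : is_derive t 1 (fun x => - c^-1 * cos (c * x)) (sin (c * t)).
  have h1 := is_derive1_comp (is_derive_cos (c * t)) (is_derive_mull c t).
  have h2 : is_derive t 1 (- c^-1 \*: (cos \o (fun x => c * x)))
      (- c^-1 *: (- sin (c * t) * c)).
    exact: is_deriveZ.
  by move: h2; rewrite [_ *: _](mulrC (- c^-1)) mulNr mulrNN mulfK.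
rewrite /= (rint_FTC (@continuous_cos_mul c) dsin) (rint_FTC (@continuous_sin_mul c) dcos).
by rewrite c2pi s2pi !mulr0 sin0 cos0 mulr0 !subrr.
Qed.

Definition tpoly n (c : nat -> R[i]) t := \sum_(i < n) c i * cexp i t.

Lemma bmf_tpoly n c : bmf (tpoly n c).
Proof.
apply: (@bmf_sum R n (fun i t => c i * cexp i t)) => i.
by apply: bmfZ; exact: bmf_cexp.
Qed.

(** Induction on the length: the new monomial has a higher frequency than all the others, hence is
    orthogonal to them. *)
Lemma rint_tpoly n c :
  rint (fun t => normc (tpoly n c t) ^+ 2) = 2 * pi * \sum_(i < n) normc (c i) ^+ 2.
Proof.
elim: n => [|n IH].
  rewrite big_ord0 mulr0 -[RHS](mulr0 (2 * pi)) -rint_cst; congr rint.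
  by apply/funext => t; rewrite /tpoly big_ord0 normc0 expr0n.
have btn := bmf_tpoly n c; have bcn := bmfZ (c n) (bmf_cexp n).
rewrite big_ord_recr mulrDr -IH.
have cross : complex.Re (cint (fun t => (c n * cexp n t)^* * tpoly n c t)) = 0.
  have -> : (fun t => (c n * cexp n t)^* * tpoly n c t) =
      (fun t => \sum_(i < n) (c n)^* * c i * cexp (i%:Z - n%:Z) t).
    apply/funext => t; rewrite mulr_sumr; apply: eq_bigr => i _.
    by rewrite conjM -cexpN addrC cexpD; ring.
  rewrite (@cint_sum R n (fun i t => (c n)^* * c i * cexp (i%:Z - n%:Z) t)); last first.
    by move=> i; apply: bmfZ; exact: bmf_cexp.
  rewrite big1// => i _; rewrite cintZ ?cint_cexp ?mulr0//; last exact: bmf_cexp.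
  by rewrite subr_eq0 eqz_nat ltn_eqF.
have b1 := bmr_normc2 btn.
have b2 : bmr (fun t => 2 * complex.Re ((c n * cexp n t)^* * tpoly n c t)).
  by apply: bmrM (bmr_cst _) _; case: (bmfM (bmf_conj bcn) btn).
rewrite (_ : (fun t => normc (tpoly n.+1 c t) ^+ 2) =
  (fun t => (normc (tpoly n c t) ^+ 2 +
    2 * complex.Re ((c n * cexp n t)^* * tpoly n c t)) + normc (c n) ^+ 2)).
  rewrite rintD; [|exact: bmrD|exact: bmr_cst].
  rewrite rintD// rintZ; last by case: (bmfM (bmf_conj bcn) btn).
  by move: cross => /= ->; rewrite mulr0 addr0 (rint_cst (normc (c n) ^+ 2)).
apply/funext => t; rewrite /tpoly big_ord_recr /=.
have -> : normc (c n) ^+ 2 = normc (c n * cexp n t) ^+ 2.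
  by rewrite normcM normc_cexp mulr1.
move: (\sum_(_ < _) _) (c n * _) => a b; rewrite !normc_sqr.
by case: a => a1 a2; case: b => b1' b2' /=; ring.
Qed.

(* Duality: the coefficients of [f] pair with [f] through the trigonometric
   polynomial they define. *)
Lemma coef_bound n f (w v : R -> R) K :
  bmr w -> (forall t, 0 <= w t) -> bmr v -> (forall t, 0 <= v t) ->
  bmf f -> (forall t, f t != 0 -> w t * v t = 1) -> 0 <= K ->
  (forall c, rint (fun t => v t * normc (tpoly n c t) ^+ 2) <=
    K * \sum_(i < n) normc (c i) ^+ 2) ->
  \sum_(i < n) normc (cint (fun t => cexp i t * f t)) ^+ 2 <=
  K * rint (fun t => w t * normc (f t) ^+ 2).
Proof.
move=> bw w0 bv v0 bf wv K0 HK.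
pose a (i : nat) := cint (fun t => cexp i t * f t).
set S := \sum_(_ < _) _.
have S0 : 0 <= S by apply: sumr_ge0 => i _; exact: sqr_ge0.
have A0 : 0 <= rint (fun t => w t * normc (f t) ^+ 2).
  by apply: rint_ge0 => t; rewrite mulr_ge0// sqr_ge0.
have pair : cint (fun t => f t * tpoly n (fun i => (a i)^*) t) = S%:C.
  have -> : (fun t => f t * tpoly n (fun i => (a i)^*) t) =
      (fun t => \sum_(i < n) (a i)^* * (cexp i t * f t)).
    by apply/funext => t; rewrite mulr_sumr; apply: eq_bigr => i _; ring.
  have bF (i : nat) : bmf (fun t => cexp i t * f t) by apply: bmfM => //; exact: bmf_cexp.
  rewrite (@cint_sum R n (fun i t => (a i)^* * (cexp i t * f t))); last first.
    by move=> i; apply: bmfZ.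
  rewrite rmorph_sum; apply: eq_bigr => i _.
  by rewrite cintZ// mulrC mulJ.
have := cint_cauchy_schwarz bw w0 bv v0 bf (bmf_tpoly n (fun i => (a i)^*)) wv.
rewrite pair normc_real real_normK ?num_real// => SS.
have := HK (fun i => (a i)^*).
rewrite (eq_bigr (fun i : 'I_n => normc (a i) ^+ 2)) => [|i _]; last by rewrite normc_conj.
rewrite -/S => h2.
have h3 : S ^+ 2 <= (K * rint (fun t => w t * normc (f t) ^+ 2)) * S.
  by apply: (le_trans SS); rewrite mulrAC mulrC ler_wpM2r.
have := S0; rewrite le_eqVlt => /predU1P[<-|Sp]; first by rewrite mulr_ge0.
by move: h3; rewrite expr2 ler_pM2r.
Qed.

End TrigonometricPolynomials.
(** * Blocks of prescribed small measure *)

Section Blocks.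
Variable R : realType.
Local Notation mu := (@lebesgue_measure R).
Local Notation D := (`[0, 2 * pi]%classic : set R).

Lemma continuous_circle : continuous (fun t : R => cos t +i* sin t : R[i]^o).
Proof.
move=> t; apply/cvgrPdist_lt => -[e e'] /= e0.
have [e'0 {}e0] : e' = 0 /\ 0 < e.
  by move: e0; rewrite ltcE /= => /andP[/eqP].
subst e'; near=> s.
have h1 : `|cos t - cos s| < e / 2.
  by near: s; apply: cvgr_dist_lt; [exact: continuous_cos|rewrite divr_gt0].
have h2 : `|sin t - sin s| < e / 2.
  by near: s; apply: cvgr_dist_lt; [exact: continuous_sin|rewrite divr_gt0].
rewrite normE ltcR; apply: (le_lt_trans (normc_le_ReIm _)) => /=.
by rewrite (splitr e) ltrD.
Unshelve. all: by end_near. Qed.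

Definition arc (E : set R[i]) : set R :=
  [set t : R | 0 <= t < 2 * pi /\ E (cos t +i* sin t)].

Lemma measurable_arc (E : set R[i]) : closed (E : set R[i]^o) -> measurable (arc E).
Proof.
move=> cE.
have -> : arc E = `[0, 2 * pi[%classic `&` (fun t : R => cos t +i* sin t) @^-1` E.
  by apply/seteqP; split=> t /=; rewrite in_itv.
apply: measurableI; first exact: measurable_itv.
apply: closed_measurable.
exact: (continuous_closedP _).1 continuous_circle _ cE.
Qed.

(** On an interval of half-width [eta / n], frequencies up to [n] turn by at most [eta] from the
    centre, so the coefficients of an indicator supported there suffer no cancellation. *)
Lemma cos_ge_half : exists2 eta : R, 0 < eta &
  forall x, `|x| <= eta -> 1 / 2 <= cos x.
Proof.
have /cvgrPdist_lt/(_ (1 / 2)) : cos x @[x --> (0 : R)] --> cos (0 : R).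
  exact: continuous_cos.
rewrite divr_gt0// => /(_ isT)/nbhs_ballP[e /= e0 he].
exists (e / 2) => [|x xe]; first by rewrite divr_gt0.
have : ball 0 e x by rewrite /ball /= sub0r normrN (le_lt_trans xe)//; lra.
by move=> /he /=; rewrite cos0 ltr_norml => /andP[h1 h2]; lra.
Qed.

Definition positive_set (A : set R) := [/\ measurable A, A `<=` D & (0 < mu A)%E].

Lemma positive_set_fin A : positive_set A -> mu A \is a fin_num.
Proof.
move=> [mA AD _]; rewrite ge0_fin_numE//; apply: (@le_lt_trans _ _ (mu D)).
  by apply: le_measure; rewrite ?inE//; exact: measurable_D.
by rewrite [X in (X < _)%E]mu_D ltry.
Qed.

(** Almost every point of [A] is a density point, so one lies in [A]; around it [A] eventually fills
    more than half of the ball, whose measure is [2 * r]. *)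
Lemma density_ball A : positive_set A -> exists x d, 0 < d /\
  forall r, 0 < r -> r < d -> (r%:E <= mu (A `&` ball x r))%E.
Proof.
move=> posA; have [mA AD A0] := posA.
have [x Ax xd] : exists2 x, A x & (mu (A `&` ball x r) / mu (ball x r))%E
    @[r --> 0^'+] --> (\1_A x)%:E.
  apply: contrapT => noex; move: A0; rewrite lt_neqAle => /andP[/eqP + _]; apply.
  apply/esym/measure_negligible => //.
  apply: negligibleS (lebesgue_density mA) => y Ay yd.
  by apply: noex; exists y.
exists x; rewrite indicE mem_set// in xd.
have half : 1 / 2 < 1 :> R by lra.
have : \forall r \near (0 : R)^'+,
    1 / 2 < fine (mu (A `&` ball x r) / mu (ball x r))%E.
  by apply: (cvgr_gt _ (fine_cvg xd) _ half).
rewrite /at_right near_withinE => /nbhs_ballP[d /= d0 hd].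
exists d; split=> // r r0 rd.
have /hd/(_ r0) /= : ball 0 d r by rewrite /ball /= sub0r normrN gtr0_norm.
rewrite (lebesgue_measure_ball _ (ltW r0)) inver mulrn_eq0 /= gt_eqF//.
have fA : mu (A `&` ball x r) \is a fin_num.
  rewrite ge0_fin_numE//; apply: (@le_lt_trans _ _ (mu A)).
    by apply: le_measure; rewrite ?inE//; apply: measurableI => //; exact: measurable_ball.
  by rewrite -ge0_fin_numE//; exact: positive_set_fin.
rewrite -{1 2}(fineK fA) -EFinM /= lee_fin ltr_pdivlMr ?pmulrn_lgt0//.
by rewrite -mulr_natr; lra.
Qed.

Lemma block_step eta A (e : R) : 0 < eta -> positive_set A -> 0 < e ->
  exists B, [/\ positive_set (A `\` B), measurable B, B `<=` A, rint \1_B <= e &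
    exists x (n : nat), [/\ (0 < n)%N, eta / 2 <= n%:R * rint \1_B &
      forall t, B t -> `|t - x| <= eta / n.+1%:R]].
Proof.
move=> eta0 posA e0; have [mA AD A0] := posA.
have [x [d [d0 dP]]] := density_ball posA.
have finA := positive_set_fin posA.
have fA0 : 0 < fine (mu A) by rewrite fine_gt0// A0 -ge0_fin_numE.
(* Three constraints on the radius: the density estimate holds below [d]; [e / 2] bounds the measure
   of the ball by [e]; [mu A / 4] leaves a remainder of positive measure. *)
pose m := Num.min d (Num.min (e / 2) (fine (mu A) / 4)).
have m0 : 0 < m by rewrite !lt_min d0 !divr_gt0.
have [n [n0 nm]] : exists n : nat, (0 < n)%N /\ eta / n.+1%:R < m.
  exists (Num.truncn (eta / m)).+1; split=> //.
  rewrite ltr_pdivrMr// mulrC -ltr_pdivrMr//.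
  by apply: (lt_trans (truncnS_gt _)); rewrite ltr_nat.
set r := eta / _ in nm; have r0 : 0 < r by rewrite divr_gt0.
have [rd re rA] : [/\ r < d, 2 * r <= e & 4 * r < fine (mu A)].
  move: nm; rewrite !lt_min => /and3P[-> h1 h2]; split=> //; lra.
pose B := A `&` ball x r.
have mB : measurable B by apply: measurableI => //; exact: measurable_ball.
have BA : B `<=` A by move=> t [].
have BD : B `<=` D by apply: subset_trans AD.
have muB := rint_indic mB BD.
have B2r : rint \1_B <= 2 * r.
  rewrite -lee_fin muB; apply: (@le_trans _ _ (mu (ball x r))).
    by apply: le_measure => [||t []//]; rewrite inE//; exact: measurable_ball.
  rewrite (lebesgue_measure_ball _ (ltW r0)) lee_fin mulr2n; lra.
exists B; split=> //; last first.
- exists x, n; split=> //.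
    (* As [r = eta / n.+1], the product [n * r] is at least [eta / 2] when [n >= 1]. *)
    have : r <= rint \1_B by rewrite -lee_fin muB; exact: dP.
    move=> /(ler_wpM2l (ler0n R n)); apply: le_trans.
    rewrite /r mulrA ler_pdivlMr// -[n.+1%:R]natr1.
    have : 1 <= n%:R :> R by rewrite ler1n.
    move: (n%:R) => k k1; have := ler_wpM2l (ltW eta0) k1; lra.
  by move=> t [_]; rewrite /ball /= distrC => /ltW.
- exact: le_trans re.
split; first exact: measurableD.
  by move=> t [/AD].
have finB : (mu B < +oo)%E by rewrite -muB ltry.
rewrite measureD//; last by rewrite -ge0_fin_numE.
rewrite setIidr// -[X in (_ - X)%E]muB -[X in (X - _)%E](fineK finA).
rewrite -EFinB lte_fin; lra.
Qed.

(** Each block is cut out of what the earlier ones leave. Once [N j] marks where [u] exceeds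
    [j.+1 * 2 ^+ j], block [j] is taken so small that lengths [n <= N j] cannot see it; larger [n]
    fall under the second alternative. *)
Lemma ex_blocks A (u : nat -> R) : positive_set A -> u @ \oo --> +oo ->
  exists (B : nat -> set R) (c : R),
    [/\ 0 < c, forall j, measurable (B j), forall j, B j `<=` A,
        forall i j t, B i t -> B j t -> i = j & forall j,
      [/\ j.+1%:R * rint \1_(B j) <= 2^-1 ^+ j,
          forall n, j.+1%:R * n%:R * rint \1_(B j) <= 2^-1 ^+ j \/
            j.+1%:R * 2 ^+ j <= u n &
          exists x (n : nat), [/\ (0 < n)%N, c <= n%:R * rint \1_(B j) &
            forall t (k : nat), B j t -> (k <= n)%N -> 1 / 2 <= cos (k%:R * (t - x))]]].
Proof.
move=> posA u_infty; have [eta eta0 cosE] := cos_ge_half.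
have /choice[N NP] : forall j : nat, exists N, forall n, (N <= n)%N ->
    j.+1%:R * 2 ^+ j <= u n.
  move=> j; have /cvgryPge/(_ (j.+1%:R * 2 ^+ j))[N _ NP] := u_infty.
  by exists N.
pose e (j : nat) : R := 2^-1 ^+ j / (j.+1%:R * (N j).+1%:R).
have e0 j : 0 < e j by rewrite divr_gt0// exprn_gt0.
have step (j : nat) (C : {A | positive_set A}) : exists B,
    [/\ positive_set (sval C `\` B), measurable B, B `<=` sval C, rint \1_B <= e j &
    exists x (n : nat), [/\ (0 < n)%N, eta / 2 <= n%:R * rint \1_B &
      forall t, B t -> `|t - x| <= eta / n.+1%:R]].
  by case: C => C posC; exact: block_step.
pose F j C := sval (cid (step j C)).
have FP j C := svalP (cid (step j C)); rewrite -/(F _ _) in FP.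
have pos_next j C : positive_set (sval C `\` F j C) by case: (FP j C).
(* The recursion carries the remaining set together with the proof that its measure is positive,
   which the next step requires. *)
pose C := fix C (j : nat) : {A | positive_set A} :=
  if j is i.+1 then exist _ _ (pos_next i (C i)) else exist _ _ posA.
pose B j := F j (C j).
have BC j : B j `<=` sval (C j) by case: (FP j (C j)).
have C_dec i j : (i <= j)%N -> sval (C j) `<=` sval (C i).
  elim: j => [|j IH]; first by rewrite leqn0 => /eqP ->.
  rewrite leq_eqVlt => /predU1P[->//|]; rewrite ltnS => /IH h t /= [Ct _].
  exact: h.
have disj i j t : (i < j)%N -> B i t -> B j t -> False.
  by move=> ij Bi /BC /(C_dec _ _ ij) /= [_]; apply.
exists B, (eta / 2); split.
- by rewrite divr_gt0.
- by move=> j; case: (FP j (C j)).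
- by move=> j; apply: subset_trans (BC j) (C_dec 0%N j _).
- move=> i j t Bi Bj; have [ij|ji|//] := ltngtP i j; exfalso.
    exact: disj ij Bi Bj.
  exact: disj ji Bj Bi.
move=> j; have [_ mB _ be [x [n [n0 cn xB]]]] := FP j (C j).
have b0 : 0 <= rint \1_(B j) by apply: rint_ge0 => t; rewrite indicE.
have bN : j.+1%:R * (N j).+1%:R * rint \1_(B j) <= 2^-1 ^+ j.
  by rewrite mulrC -ler_pdivlMr ?mulr_gt0.
split.
- apply: le_trans bN; rewrite ler_wpM2r// ler_peMr//.
  by rewrite ler1n.
- move=> k; have [kN|Nk] := leqP k (N j); last by right; apply: NP; exact: ltnW.
  left; apply: le_trans bN; rewrite ler_wpM2r// ler_wpM2l// ler_nat.
  exact: leqW.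
exists x, n; split=> // t k Bt kn; apply: cosE.
rewrite normrM normr_nat; apply: (le_trans (ler_wpM2l _ (xB _ Bt))) => //.
rewrite mulrCA ler_piMr ?(ltW eta0)// ler_pdivrMr// mul1r ler_nat.
exact: leqW.
Qed.

End Blocks.
(** * Sequences with b(n+1) = lam b(n) + a(n) *)

Section ResolventSequences.
Variable R : realType.
Implicit Types (a b : nat -> R[i]) (lam : R[i]).

Definition sqsum N a : R := \sum_(n < N) normc (a n) ^+ 2.

Lemma sqsum_ge0 N a : 0 <= sqsum N a.
Proof. by apply: sumr_ge0 => n _; exact: sqr_ge0. Qed.

Lemma sqsumS N a : sqsum N.+1 a = sqsum N a + normc (a N) ^+ 2.
Proof. by rewrite /sqsum big_ord_recr. Qed.

Lemma sqsum_shift N a : normc (a 0%N) ^+ 2 + sqsum N (fun n => a n.+1) = sqsum N.+1 a.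
Proof. by rewrite /sqsum [in RHS]big_ord_recl. Qed.

(* Convexity of the square at [q * (z1 / q) + (1 - q) * (z2 / (1 - q))]. *)
Lemma normc_sqr_convex q (z1 z2 : R[i]) : 0 < q -> q < 1 ->
  normc (z1 + z2) ^+ 2 <= normc z1 ^+ 2 / q + normc z2 ^+ 2 / (1 - q).
Proof.
move=> q0 q1; have q1' : 0 < 1 - q by lra.
have := normcD z1 z2; have := normc_ge0 (z1 + z2).
move: (normc (z1 + z2)) (normc z1) (normc z2) => x y z x0 xyz.
have : x ^+ 2 <= (y + z) ^+ 2 by rewrite ler_pXn2r ?nnegrE// (le_trans x0).
move=> /le_trans; apply; rewrite -subr_ge0.
have -> : y ^+ 2 / q + z ^+ 2 / (1 - q) - (y + z) ^+ 2 =
    ((1 - q) * y - q * z) ^+ 2 / (q * (1 - q)) by field; rewrite !gt_eqF.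
by rewrite divr_ge0 ?sqr_ge0// mulr_ge0// ltW.
Qed.

(** Common end of the two cases [|lam| != 1], which both lead to [x <= q * x + M + S / (1 - q)]. *)
Lemma le_geometric (q x S M : R) : 0 < q -> q < 1 -> 0 <= M ->
  x * (1 - q) <= M + S / (1 - q) -> x <= (1 - q)^-1 ^+ 2 * (S + M).
Proof.
move=> q0 q1 M0 h; have q1' : 0 < 1 - q by lra.
rewrite expr2 -mulrA mulrC -ler_pdivrMr ?invr_gt0// invrK; apply: (le_trans h).
rewrite mulrDr addrC [_ * S]mulrC lerD2l ler_peMl// invf_ge1//; lra.
Qed.

Lemma sqsum_contracting a b lam S M N : normc lam < 1 ->
  (forall n, b n.+1 = lam * b n + a n) -> (forall N, sqsum N a <= S) ->
  (forall n, normc (b n) ^+ 2 <= M) ->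
  sqsum N b <= (2 / (1 - normc lam)) ^+ 2 * (S + M).
Proof.
move=> lam1 bS aS bM.
have lam0 := normc_ge0 lam.
(* The midpoint between [|lam|] and 1 is positive even for [lam = 0], and satisfies
   [|lam|^2 / q <= q]. *)
pose q := (1 + normc lam) / 2.
have q0 : 0 < q by rewrite /q; lra.
have q1 : q < 1 by rewrite /q; lra.
have lq : normc lam <= q by rewrite /q; lra.
have step n : normc (b n.+1) ^+ 2 <= q * normc (b n) ^+ 2 + normc (a n) ^+ 2 / (1 - q).
  rewrite bS; apply: (le_trans (normc_sqr_convex _ _ q0 q1)); rewrite lerD2r.
  rewrite normcM exprMn mulrAC ler_wpM2r ?sqr_ge0// ler_pdivrMr//.
  by rewrite -expr2 ler_pXn2r// ?nnegrE// ltW.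
have sum n : sqsum n.+1 b <= M + q * sqsum n b + sqsum n a / (1 - q).
  rewrite -sqsum_shift -addrA lerD// /sqsum mulr_sumr mulr_suml -big_split.
  by apply: ler_sum => i _; exact: step.
have M0 : 0 <= M by apply: le_trans (bM 0%N); exact: sqr_ge0.
have q1' : 0 < 1 - q by lra.
have -> : 2 / (1 - normc lam) = (1 - q)^-1 by rewrite /q; field; lra.
have mono : sqsum N b <= sqsum N.+1 b by rewrite sqsumS lerDl sqr_ge0.
apply: le_geometric => //.
have h1 : sqsum N a / (1 - q) <= S / (1 - q) by rewrite ler_pM2r ?invr_gt0.
have := sum N; move: mono h1; move: (_ / (1 - q)) (_ / (1 - q)) => x y; lra.
Qed.

(** For [|lam| > 1] the recursion contracts when solved backwards, [b n = lam^-1 * (b n.+1 - a n)];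
    the index shift costs one boundary term, at most [M]. *)
Lemma sqsum_expanding a b lam S M N : 1 < normc lam ->
  (forall n, b n.+1 = lam * b n + a n) -> (forall N, sqsum N a <= S) ->
  (forall n, normc (b n) ^+ 2 <= M) ->
  sqsum N b <= (1 - (normc lam)^-1)^-1 ^+ 2 * (S + M).
Proof.
move=> lam1 bS aS bM; have lam0 : 0 < normc lam by lra.
have lamN0 : lam != 0 by apply: contraTneq lam0 => ->; rewrite normc0 ltxx.
pose q := (normc lam)^-1.
have q0 : 0 < q by rewrite invr_gt0.
have q1 : q < 1 by rewrite invf_lt1.
have q1' : 0 < 1 - q by lra.
have step n : normc (b n) ^+ 2 <= q * normc (b n.+1) ^+ 2 + normc (a n) ^+ 2 / (1 - q).
  have -> : b n = lam^-1 * b n.+1 + - (lam^-1 * a n).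
    by rewrite bS mulrDr mulKf// addrK.
  apply: (le_trans (normc_sqr_convex _ _ q0 q1)).
  rewrite normc_opp !normcM normcV -/q !exprMn; apply: lerD.
    by rewrite mulrAC expr2 mulfK// gt_eqF.
  by rewrite ler_pM2r ?invr_gt0// ler_piMl ?sqr_ge0// expr_le1 ?ltW.
have M0 : 0 <= M by apply: le_trans (bM 0%N); exact: sqr_ge0.
apply: le_geometric => //; rewrite -/q.
have h1 : sqsum N a / (1 - q) <= S / (1 - q) by rewrite ler_pM2r ?invr_gt0.
have h2 : sqsum N b <= q * sqsum N (fun n => b n.+1) + sqsum N a / (1 - q).
  rewrite /sqsum mulr_sumr mulr_suml -big_split.
  by apply: ler_sum => i _; exact: step.
have h3 : sqsum N (fun n => b n.+1) <= sqsum N b + M.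
  apply: (@le_trans _ _ (sqsum N.+1 b)).
    by rewrite -sqsum_shift lerDr sqr_ge0.
  by rewrite sqsumS lerD2l.
have h4 : q * sqsum N (fun n => b n.+1) <= q * sqsum N b + M.
  apply: (@le_trans _ _ (q * (sqsum N b + M))); first by rewrite ler_pM2l.
  by rewrite mulrDr lerD2l ler_piMl// ltW.
move: h1 h2 h4; move: (_ / (1 - q)) (_ / (1 - q)) => x y; lra.
Qed.

(** The increments of [y] increase up to errors [2 * c * 2^-1 ^+ k.+1], of total [2 * c], and end up
    at most arbitrarily small since [y] tends to 0. As [G] is absent from the conclusion, it may
    depend on the truncation length. *)
Lemma convex_decay (y : nat -> R) (c G : R) : 0 <= c -> (forall k, 0 <= y k) ->
  (forall k, y k.+1 <= (y k + y k.+2) / 2 + c * 2^-1 ^+ k.+1) ->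
  (forall k, y k <= G * 2^-1 ^+ k) -> y 1%N <= y 0%N + 2 * c.
Proof.
move=> c0 y0 yc yG.
have G0 : 0 <= G by have := le_trans (y0 0%N) (yG 0%N); rewrite expr0 mulr1.
have h K : y 1%N - y 0%N <= y K.+1 - y K + 2 * c * (1 - 2^-1 ^+ K).
  elim: K => [|K IH]; first by rewrite expr0 subrr mulr0 addr0.
  have := yc K; move: IH; rewrite exprS; move: (2^-1 ^+ K) => e; lra.
apply/ler_addgt0Pr => e e0.
have [|K Ke] := @invSn_small R (e / (G + 1)); first by rewrite divr_gt0//; lra.
have p2 : 2^-1 ^+ K.+1 <= K.+1%:R^-1 :> R.
  by rewrite exprVn lef_pV2 ?posrE ?exprn_gt0// -natrX ler_nat ltnW// ltn_expl.
have pK : 0 <= 2^-1 ^+ K :> R by rewrite exprn_ge0.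
have hG : y K.+1 <= e.
  apply: (le_trans (yG _)); apply: (@le_trans _ _ (G * K.+1%:R^-1)).
    by rewrite ler_wpM2l.
  move: Ke; rewrite ler_pdivlMr; last lra.
  by have := invSn_gt0 R K; move: (K.+1%:R^-1) => t; lra.
have h1 : 2 * c * (1 - 2^-1 ^+ K) <= 2 * c by nra.
by have := h K; have := y0 K; move: h1; move: (2 * c * _) => x; lra.
Qed.

Lemma sum_normc_mul N a b (s : R) : 0 < s ->
  \sum_(n < N) normc (a n) * normc (b n) <= (s * sqsum N a + sqsum N b / s) / 2.
Proof.
move=> s0; rewrite /sqsum mulr_sumr mulr_suml -big_split mulr_suml.
apply: ler_sum => i _ /=; move: (normc (a i)) (normc (b i)) => x y.
rewrite -subr_ge0; have -> : (s * x ^+ 2 + y ^+ 2 / s) / 2 - x * y = (s * x - y) ^+ 2 / s / 2.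
  by field; rewrite gt_eqF.
by rewrite !divr_ge0 ?sqr_ge0// ltW.
Qed.

(* Summation by parts: with [f n = c n.+1 - lam * c n] and [f n.+1 - lam * f n = g n],
   the terms [f n.+1 * (c n.+1)^*] and [f n * (c n)^*] telescope. *)
Lemma sqsum_by_parts lam (g f c : nat -> R[i]) N : normc lam = 1 ->
  (forall n, f n.+1 = lam * f n + g n) -> (forall n, c n.+1 = lam * c n + f n) ->
  sqsum N f <= normc (f N) * normc (c N) + normc (f 0%N) * normc (c 0%N) +
    \sum_(n < N) normc (g n) * normc (c n.+1).
Proof.
move=> lam1 fS cS.
have ll : lam^* * lam = 1 by rewrite mulrC mulJ lam1 expr1n.
have fE n : (normc (f n) ^+ 2)%:C = lam^* * (f n.+1 * (c n.+1)^* - f n * (c n)^*)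
    - lam^* * (g n * (c n.+1)^*).
  rewrite -mulJ; have -> : (f n)^* = (c n.+1)^* - lam^* * (c n)^*.
    by rewrite cS conjD conjM addrAC subrr add0r.
  rewrite fS; transitivity ((lam^* * lam) * f n * (c n.+1)^* - lam^* * (f n * (c n)^*)).
    by rewrite ll mul1r; ring.
  ring.
have sumE : (sqsum N f)%:C = lam^* * (f N * (c N)^* - f 0%N * (c 0%N)^*)
    - lam^* * \sum_(n < N) (g n * (c n.+1)^*).
  elim: N => [|N IH].
    by rewrite /sqsum !big_ord0 subrr !mulr0 subr0.
  rewrite sqsumS rmorphD /= -/((sqsum N f)%:C) IH fE big_ord_recr /=; ring.
have := sqsum_ge0 N f => S0.
rewrite -(ger0_norm S0) -normc_real sumE.
apply: (le_trans (normcD _ _)); rewrite normc_opp !normcM !normc_conj lam1 !mul1r.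
apply: lerD.
  by apply: (le_trans (normcD _ _)); rewrite normc_opp !normcM !normc_conj.
elim: (N) => [|n IH]; first by rewrite !big_ord0 normc0.
rewrite !big_ord_recr; apply: (le_trans (normcD _ _)).
by rewrite normcM normc_conj lerD2r.
Qed.

(* [X k = sqsum N (b k)] satisfies [X k.+1 <= (X k / e + e * X k.+2) / 2] up to the
   boundary terms of the summation by parts, so [e ^+ k * X k] is convex up to a
   geometric error. It tends to 0, since [X k] is [O(d^-1 ^+ (2 * k))] and
   [e < d ^+ 2], and this bounds [X 1] by [X 0] uniformly in [N]. *)
Lemma sqsum_unimodular lam (b : nat -> nat -> R[i]) (m d S : R) N :
  normc lam = 1 -> 0 < d -> 0 <= m ->
  (forall k n, b k.+1 n.+1 = lam * b k.+1 n + b k n) ->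
  (forall k n, normc (b k n) <= m * d^-1 ^+ k) ->
  (forall N, sqsum N (b 0%N) <= S) ->
  sqsum N (b 1%N) <= (2 / d ^+ 2) * (S + (4 / d + 1) * m ^+ 2).
Proof.
move=> lam1 d0 m0 bS bm aS.
(* Chosen so that [e / d ^+ 2] is one half: the rescaled bounds on [b k] decay like [2^-1 ^+ k]. *)
pose e := d ^+ 2 / 2.
have e0 : 0 < e by rewrite divr_gt0// exprn_gt0.
have ed : e * d^-1 ^+ 2 = 2^-1 by rewrite /e; field; rewrite gt_eqF.
pose y k := e ^+ k * sqsum N (b k).
have D0 k : 0 <= m * d^-1 ^+ k by rewrite mulr_ge0// exprn_ge0// invr_ge0 ltW.
have bm2 k n : normc (b k n) ^+ 2 <= m ^+ 2 * d^-1 ^+ 2 ^+ k.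
  by rewrite exprAC -exprMn ler_pXn2r ?nnegrE ?normc_ge0.
have eX k : e ^+ k * d^-1 ^+ 2 ^+ k = 2^-1 ^+ k by rewrite -exprMn ed.
have pair k n : normc (b k.+1 n) * normc (b k.+2 n) <= m ^+ 2 / d * d^-1 ^+ 2 ^+ k.+1.
  apply: (le_trans (ler_pM (normc_ge0 _) (normc_ge0 _) (bm _ _) (bm _ _))).
  rewrite le_eqVlt; apply/orP; left; apply/eqP.
  by rewrite [d^-1 ^+ k.+2]exprS -exprM mulnC exprM; ring.
have step k : y k.+1 <= (y k + y k.+2) / 2 +
    (2 / d + 1 / 2) * m ^+ 2 * 2^-1 ^+ k.+1.
  have h1 := sqsum_by_parts N lam1 (bS k) (bS k.+1).
  have eV0 : 0 < e^-1 by rewrite invr_gt0.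
  have := sum_normc_mul N (b k) (fun n => b k.+2 n.+1) eV0; rewrite invrK => h2.
  have h3 : sqsum N (fun n => b k.+2 n.+1) <= sqsum N (b k.+2) + m ^+ 2 * d^-1 ^+ 2 ^+ k.+2.
    apply: (@le_trans _ _ (sqsum N.+1 (b k.+2))).
      by rewrite -sqsum_shift lerDr sqr_ge0.
    by rewrite sqsumS lerD2l.
  have ek : 0 < e ^+ k.+1 by rewrite exprn_gt0.
  have h4 : sqsum N (b k.+1) <= m ^+ 2 / d * d^-1 ^+ 2 ^+ k.+1 + m ^+ 2 / d * d^-1 ^+ 2 ^+ k.+1
      + (e^-1 * sqsum N (b k) + (sqsum N (b k.+2) + m ^+ 2 * d^-1 ^+ 2 ^+ k.+2) * e) / 2.
    apply: (le_trans h1); apply: lerD; first exact: lerD.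
    apply: (le_trans h2); rewrite ler_pM2r// lerD2l.
    by rewrite ler_pM2r.
  rewrite /y; apply: (le_trans (ler_wpM2l (ltW ek) h4)).
  have -> : e ^+ k.+1 * (m ^+ 2 / d * d^-1 ^+ 2 ^+ k.+1 + m ^+ 2 / d * d^-1 ^+ 2 ^+ k.+1 +
      (e^-1 * sqsum N (b k) + (sqsum N (b k.+2) + m ^+ 2 * d^-1 ^+ 2 ^+ k.+2) * e) / 2) =
    (e ^+ k * (e / e) * sqsum N (b k) + e ^+ k.+2 * sqsum N (b k.+2)) / 2 +
    (2 / d * m ^+ 2 * (e ^+ k.+1 * d^-1 ^+ 2 ^+ k.+1) +
      m ^+ 2 / 2 * (e ^+ k.+2 * d^-1 ^+ 2 ^+ k.+2)).
    by rewrite !exprS; ring.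
  rewrite mulfV ?gt_eqF// mulr1 !eX lerD2l [2^-1 ^+ k.+2]exprS.
  have : 0 <= 2^-1 ^+ k.+1 :> R by rewrite exprn_ge0.
  have := sqr_ge0 m; move: (2^-1 ^+ k.+1) (m ^+ 2) => p q q0 p0.
  by have := mulr_ge0 q0 p0; move: (2 / d) => w; lra.
(* The constant grows with [N], but only the decay in [k] enters [convex_decay]. *)
have yG k : y k <= N%:R * m ^+ 2 * 2^-1 ^+ k.
  rewrite -eX mulrCA ler_pM2l ?exprn_gt0// /sqsum.
  apply: (@le_trans _ _ (\sum_(n < N) m ^+ 2 * d^-1 ^+ 2 ^+ k)).
    by apply: ler_sum => i _.
  by rewrite sumr_const card_ord -[_ *+ N]mulr_natl le_eqVlt; apply/orP; left; apply/eqP; ring.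
have y0 k : 0 <= y k by rewrite mulr_ge0 ?sqsum_ge0// exprn_ge0// ltW.
have c0 : 0 <= (2 / d + 1 / 2) * m ^+ 2.
  by rewrite mulr_ge0 ?sqr_ge0// addr_ge0// divr_ge0// ltW.
have := convex_decay c0 y0 step yG; rewrite /y expr1 expr0 mul1r.
have := aS N => h1 h2; have -> : 2 / d ^+ 2 = e^-1 by rewrite /e; field; rewrite gt_eqF.
rewrite mulrC ler_pdivlMr// mulrC; apply: (le_trans h2).
move: h1; move: (m ^+ 2) (d^-1) => p q; lra.
Qed.

End ResolventSequences.

(** * Square-summable sequences and their inner product *)

Section SquareSummable.
Variable R : realType.
Implicit Types (a b x y : nat -> R[i]) (c s t : R[i]).

Definition psum N x : R[i] := \sum_(k < N) x k.

Definition csums x s := forall e : R, 0 < e ->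
  exists N0, forall N, (N0 <= N)%N -> normc (s - psum N x) <= e.

Lemma csums_unique x s t : csums x s -> csums x t -> s = t.
Proof.
move=> xs xt; apply: (@eq_small _ _ _ 2) => e e0 _.
have [N sN] := xs e e0; have [M tM] := xt e e0.
have h1 := sN (maxn N M) (leq_maxl _ _); have h2 := tM (maxn N M) (leq_maxr _ _).
have -> : s - t = (s - psum (maxn N M) x) - (t - psum (maxn N M) x) by ring.
by apply: (le_trans (normcD _ _)); rewrite normc_opp; lra.
Qed.

Lemma csums_lin c x y s t : csums x s -> csums y t ->
  csums (fun k => c * x k + y k) (c * s + t).
Proof.
move=> xs yt e e0; have c0 := normc_ge0 c.
have e1 : 0 < e / (2 * (normc c + 1)) by rewrite divr_gt0//; lra.
have e2 : 0 < e / 2 by rewrite divr_gt0.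
have [N sN] := xs _ e1; have [M tM] := yt _ e2.
exists (maxn N M) => n; rewrite geq_max => /andP[/sN h1 /tM h2].
have -> : c * s + t - psum n (fun k => c * x k + y k) =
    c * (s - psum n x) + (t - psum n y).
  by rewrite /psum big_split /= -mulr_sumr; ring.
apply: (le_trans (normcD _ _)); rewrite normcM.
have h3 : normc c * normc (s - psum n x) <= e / 2.
  apply: (le_trans (ler_wpM2l c0 h1)); rewrite mulrA ler_pdivrMr; last lra.
  have -> : e / 2 * (2 * (normc c + 1)) = e * (normc c + 1) by field.
  by rewrite mulrC ler_wpM2l ?ltW//; lra.
by rewrite (splitr e) lerD.
Qed.

Lemma csums_conj x s : csums x s -> csums (fun k => (x k)^*) s^*.
Proof.
move=> xs e e0; have [N sN] := xs e e0; exists N => n /sN.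
have -> : psum n (fun k => (x k)^*) = (psum n x)^* by rewrite /psum rmorph_sum.
by rewrite -conjB normc_conj.
Qed.

Lemma csums_shift x s : csums (fun k => x k.+1) s -> csums x (x 0%N + s).
Proof.
move=> xs e e0; have [N sN] := xs e e0; exists N.+1 => -[//|n] /sN.
by rewrite [psum n.+1 x]/psum big_ord_recl opprD addrACA subrr add0r.
Qed.

Lemma Re_psum N x : complex.Re (psum N x) = \sum_(k < N) complex.Re (x k).
Proof. by elim: N => [|N IH]; rewrite /psum ?big_ord0// !big_ord_recr Re_D -IH. Qed.

Lemma Im_psum N x : complex.Im (psum N x) = \sum_(k < N) complex.Im (x k).
Proof. by elim: N => [|N IH]; rewrite /psum ?big_ord0// !big_ord_recr Im_D -IH. Qed.

Lemma real_series_cvg (r : nat -> R) (q : nat -> R) (M : R) :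
  (forall k, `|r k| <= q k) -> (forall N, \sum_(k < N) q k <= M) ->
  cvgn (fun N => \sum_(k < N) r k).
Proof.
move=> rq qM; have -> : (fun N => \sum_(k < N) r k) = series r.
  by apply/funext => N; rewrite seriesEord.
apply: normed_cvg; apply: (@nondecreasing_is_cvgn _ (series (fun k => `|r k|))).
  apply/nondecreasing_seqP => n; rewrite seriesEord.
  by rewrite [leRHS]big_ord_recr lerDl /=.
exists M => _ [N _ <-]; rewrite seriesEord; apply: le_trans (qM N).
by apply: ler_sum => i _.
Qed.

Lemma csums_exists x (q : nat -> R) (M : R) : (forall k, normc (x k) <= q k) ->
  (forall N, \sum_(k < N) q k <= M) -> exists s, csums x s.
Proof.
move=> xq qM.
have cRe : cvgn (fun N => \sum_(k < N) complex.Re (x k)).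
  apply: (@real_series_cvg (fun k => complex.Re (x k)) q M) => // k.
  by apply: le_trans (xq k); exact: normc_Re.
have cIm : cvgn (fun N => \sum_(k < N) complex.Im (x k)).
  apply: (@real_series_cvg (fun k => complex.Im (x k)) q M) => // k.
  by apply: le_trans (xq k); exact: normc_Im.
exists (limn (fun N => \sum_(k < N) complex.Re (x k)) +i*
        limn (fun N => \sum_(k < N) complex.Im (x k))) => e e0.
have e2 : 0 < e / 2 by rewrite divr_gt0.
have /cvgrPdist_le/(_ _ e2)[N1 _ h1] := cRe.
have /cvgrPdist_le/(_ _ e2)[N2 _ h2] := cIm.
exists (maxn N1 N2) => N; rewrite geq_max => /andP[/h1 {}h1 /h2 {}h2].
apply: (le_trans (normc_le_ReIm _)); rewrite (splitr e).
by move: h1 h2; rewrite /= -Re_psum -Im_psum; case: (psum N x) => p q' /= h1 h2; rewrite lerD.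
Qed.

Definition sqbounded a := exists M, forall N, sqsum N a <= M.

(** The value is 0 by default for a divergent series; [l2dotP] rules this out for square-summable
    arguments. *)
Definition l2dot a b : R[i] := xget 0 (csums (fun k => a k * (b k)^*)).

Lemma l2dotP a b : sqbounded a -> sqbounded b ->
  csums (fun k => a k * (b k)^*) (l2dot a b).
Proof.
move=> [M aM] [L bL].
have [|N|s sP] := @csums_exists (fun k => a k * (b k)^*)
    (fun k => normc (a k) ^+ 2 + normc (b k) ^+ 2) (M + L).
- move=> k; rewrite normcM normc_conj.
  have := sqr_ge0 (normc (a k) - normc (b k)); rewrite sqrrB.
  have := normc_ge0 (a k); have := normc_ge0 (b k); nra.
- by rewrite big_split lerD//; [exact: aM|exact: bL].
by rewrite /l2dot; case: xgetP => [y _ //|h]; have := h s sP.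
Qed.

Lemma l2dot_unique a b s : sqbounded a -> sqbounded b ->
  csums (fun k => a k * (b k)^*) s -> l2dot a b = s.
Proof. by move=> /l2dotP h /h; exact: csums_unique. Qed.

Lemma sqbounded_lin c a b : sqbounded a -> sqbounded b ->
  sqbounded (fun k => c * a k + b k).
Proof.
move=> [M aM] [L bL]; exists (2 * (normc c ^+ 2 * M) + 2 * L) => N.
apply: (@le_trans _ _ (2 * (normc c ^+ 2 * sqsum N a) + 2 * sqsum N b)); last first.
  by rewrite lerD// ler_pM2l// ler_wpM2l ?sqr_ge0.
rewrite /sqsum !mulr_sumr -big_split; apply: ler_sum => k _ /=.
have := normcD (c * a k) (b k); rewrite normcM -exprMn.
have := normc_ge0 (c * a k + b k); move: (normc (_ + _)) (normc c * _) (normc (b k)) => x y z x0 xyz.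
have : x ^+ 2 <= (y + z) ^+ 2 by rewrite ler_pXn2r ?nnegrE// (le_trans x0).
by have := sqr_ge0 (y - z); rewrite sqrrB sqrrD; lra.
Qed.

Lemma l2dot_lin c a a' b : sqbounded a -> sqbounded a' -> sqbounded b ->
  l2dot (fun k => c * a k + a' k) b = c * l2dot a b + l2dot a' b.
Proof.
move=> sa sa' sb; apply: l2dot_unique => //; first exact: sqbounded_lin.
have := csums_lin c (l2dotP sa sb) (l2dotP sa' sb).
by under eq_fun do rewrite mulrA -mulrDl.
Qed.

Lemma l2dotC a b : sqbounded a -> sqbounded b -> l2dot b a = (l2dot a b)^*.
Proof.
move=> sa sb; apply: l2dot_unique => //.
have := csums_conj (l2dotP sa sb).
by under eq_fun do rewrite conjM conjCK mulrC.
Qed.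

Lemma sqbounded_shift a : sqbounded a -> sqbounded (fun k => a k.+1).
Proof.
move=> [M aM]; exists M => N; apply: le_trans (aM N.+1).
by rewrite -sqsum_shift lerDr sqr_ge0.
Qed.

Lemma l2dot_shift a b : sqbounded a -> sqbounded b ->
  l2dot a b = a 0%N * (b 0%N)^* + l2dot (fun k => a k.+1) (fun k => b k.+1).
Proof.
move=> sa sb; apply: l2dot_unique => //.
apply: (csums_shift (x := fun k => a k * (b k)^*)).
exact: l2dotP (sqbounded_shift sa) (sqbounded_shift sb).
Qed.

Definition l2norm2 a : R := complex.Re (l2dot a a).

Lemma psum_sqr N a : psum N (fun k => a k * (a k)^*) = (sqsum N a)%:C.
Proof. by rewrite /psum /sqsum rmorph_sum; apply: eq_bigr => k _; rewrite mulJ. Qed.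

Lemma l2norm2_le a M : (forall N, sqsum N a <= M) -> l2norm2 a <= M.
Proof.
move=> aM; have sa : sqbounded a by exists M.
apply/ler_addgt0Pr => e e0; have [N /(_ N (leqnn _))] := l2dotP sa sa e0.
rewrite psum_sqr => /(le_trans (normc_Re _)); rewrite Re_D Re_N /= ler_norml.
by move=> /andP[_]; have := aM N; rewrite /l2norm2; lra.
Qed.

Lemma le_l2norm2 a N : sqbounded a -> sqsum N a <= l2norm2 a.
Proof.
move=> sa; apply/ler_addgt0Pr => e e0; have [M hM] := l2dotP sa sa e0.
have := hM (maxn M N) (leq_maxl _ _).
rewrite psum_sqr => /(le_trans (normc_Re _)); rewrite Re_D Re_N /= ler_norml.
move=> /andP[h _]; have : sqsum N a <= sqsum (maxn M N) a.
  have mono k l : sqsum k a <= sqsum (k + l) a.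
    by elim: l => [|l IH]; rewrite ?addn0// addnS sqsumS (le_trans IH)// lerDl sqr_ge0.
  by rewrite -(subnKC (leq_maxr M N)).
by rewrite /l2norm2; lra.
Qed.

Lemma l2norm2_ge0 a : sqbounded a -> 0 <= l2norm2 a.
Proof. by move=> /(le_l2norm2 0); apply: le_trans; exact: sqsum_ge0. Qed.

(** Multiplication by [z^N] turns coefficients into such a tail, so it can make the second part of
    the norm negligible. *)
Lemma l2norm2_tail a (e : R) : sqbounded a -> 0 < e ->
  exists N, l2norm2 (fun k => a (N + k)%N) <= e.
Proof.
move=> sa e0; have [N /(_ N (leqnn _))] := l2dotP sa sa e0.
rewrite psum_sqr => /(le_trans (normc_Re _)); rewrite Re_D Re_N /= ler_norml.
move=> /andP[_ h]; exists N; apply: l2norm2_le => M.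
have -> : sqsum M (fun k => a (N + k)%N) = sqsum (N + M) a - sqsum N a.
  elim: M => [|M IH]; first by rewrite addn0 subrr /sqsum big_ord0.
  by rewrite addnS !sqsumS IH; ring.
by have := le_l2norm2 (N + M) sa; move: h; rewrite -/(l2norm2 a); lra.
Qed.

End SquareSummable.
(** * The weighted space of functions on the blocks *)

(** Finitely many blocks, so that the inverse of the weight is bounded on the support; plain
    functions rather than classes, null functions being absorbed by the completion. *)
Record blockfun (R : realType) (B : nat -> set R) := Blockfun {
  bfun :> R -> R[i];
  bfun_bmf : bmf bfun;
  bfun_supp : exists J, forall t, (forall j, (j < J)%N -> ~ B j t) -> bfun t = 0 }.

Section BlockfunModule.
Variables (R : realType) (B : nat -> set R).
Local Notation V := (blockfun B).
Implicit Types (f g h : V) (a : R[i]).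

Lemma blockfun_eq f g : (forall t, f t = g t) -> f = g.
Proof.
case: f g => [f f1 f2] [g g1 g2] /= /funext fg; case: _ / fg in g1 g2 *.
by congr Blockfun; exact: Prop_irrelevance.
Qed.

HB.instance Definition _ := gen_eqMixin V.
HB.instance Definition _ := gen_choiceMixin V.

Lemma supp_lin a f g :
  exists J, forall t, (forall j, (j < J)%N -> ~ B j t) -> a * f t + g t = 0.
Proof.
have [J fJ] := bfun_supp f; have [K gK] := bfun_supp g.
exists (maxn J K) => t tB; rewrite fJ ?gK ?mulr0 ?addr0// => j jJ; apply: tB.
  by rewrite (leq_trans jJ)// leq_maxr.
by rewrite (leq_trans jJ)// leq_maxl.
Qed.

Definition blockfun0 : V :=
  @Blockfun R B (fun=> 0) (bmf_cst 0) (ex_intro _ 0%N (fun t _ => erefl)).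
Definition blockfun_lin a f g : V :=
  Blockfun (bmfD (bmfZ a (bfun_bmf f)) (bfun_bmf g)) (supp_lin a f g).
Definition blockfun_add f g := blockfun_lin 1 f g.
Definition blockfun_opp f := blockfun_lin (- 1) f blockfun0.
Definition blockfun_scale a f := blockfun_lin a f blockfun0.

Lemma blockfun_addA : associative blockfun_add.
Proof. by move=> f g h; apply: blockfun_eq => y /=; ring. Qed.
Lemma blockfun_addC : commutative blockfun_add.
Proof. by move=> f g; apply: blockfun_eq => y /=; ring. Qed.
Lemma blockfun_add0 : left_id blockfun0 blockfun_add.
Proof. by move=> f; apply: blockfun_eq => y /=; ring. Qed.
Lemma blockfun_addN : left_inverse blockfun0 blockfun_opp blockfun_add.
Proof. by move=> f; apply: blockfun_eq => y /=; ring. Qed.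

HB.instance Definition _ := GRing.isZmodule.Build V
  blockfun_addA blockfun_addC blockfun_add0 blockfun_addN.

Lemma blockfun_scaleA a b f :
  blockfun_scale a (blockfun_scale b f) = blockfun_scale (a * b) f.
Proof. by apply: blockfun_eq => y /=; ring. Qed.
Lemma blockfun_scale1 : left_id 1 blockfun_scale.
Proof. by move=> f; apply: blockfun_eq => y /=; ring. Qed.
Lemma blockfun_scaleDr : right_distributive blockfun_scale +%R.
Proof. by move=> a f g; apply: blockfun_eq => y /=; ring. Qed.
Lemma blockfun_scaleDl f : {morph blockfun_scale^~ f : a b / a + b}.
Proof. by move=> a b; apply: blockfun_eq => y /=; ring. Qed.

HB.instance Definition _ := GRing.Zmodule_isLmodule.Build R[i] V
  blockfun_scaleA blockfun_scale1 blockfun_scaleDr blockfun_scaleDl.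

Lemma bfunP a f g t : (a *: f + g) t = a * f t + g t.
Proof. by rewrite [LHS]/= addr0 mul1r. Qed.

Lemma bfunB f g t : (f - g) t = f t - g t.
Proof. by rewrite [LHS]/= mulN1r addr0 mul1r. Qed.

Lemma bfunZ a f t : (a *: f) t = a * f t.
Proof. by rewrite [LHS]/= addr0. Qed.

Lemma supp_mul (g : R -> R[i]) f :
  exists J, forall t, (forall j, (j < J)%N -> ~ B j t) -> g t * f t = 0.
Proof. by have [J fJ] := bfun_supp f; exists J => t /fJ ->; rewrite mulr0. Qed.

Definition bmul_fun (g : R -> R[i]) (bg : bmf g) f : V :=
  Blockfun (bmfM bg (bfun_bmf f)) (supp_mul g f).

Lemma bmul_linear (g : R -> R[i]) (bg : bmf g) : linear (bmul_fun bg).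
Proof. by move=> a f h; apply: blockfun_eq => t; rewrite bfunP /= !(addr0, mul1r); ring. Qed.

HB.instance Definition _ (g : R -> R[i]) (bg : bmf g) :=
  GRing.isLinear.Build R[i] V V _ (bmul_fun bg) (@bmul_linear g bg).

Definition bmul (g : R -> R[i]) (bg : bmf g) : {linear V -> V} := bmul_fun bg.

Lemma bmulE (g : R -> R[i]) (bg : bmf g) f t : bmul bg f t = g t * f t.
Proof. by []. Qed.

End BlockfunModule.

(** * The weight and the inner product *)

Section BlockForm.
Variables (R : realType) (B : nat -> set R).
Hypothesis mB : forall j, measurable (B j).
Hypothesis disjB : forall i j t, B i t -> B j t -> i = j.
Local Notation V := (blockfun B).
Implicit Types (f g : V) (a : R[i]).

(* [weight] is [1 / j.+1] on the block [B j]; [dens J] is its inverse on the first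
   [J] blocks. *)
Definition wsum J (t : R) : R := \sum_(j < J) j.+1%:R^-1 * \1_(B j) t.
Definition weight (t : R) : R := limn (fun J => wsum J t).
Definition dens J (t : R) : R := \sum_(j < J) j.+1%:R * \1_(B j) t.

Lemma block_sum (c : nat -> R) J j t : B j t ->
  \sum_(i < J) c i * \1_(B i) t = if (j < J)%N then c j else 0.
Proof.
move=> Bj; elim: J => [|J IH]; first by rewrite big_ord0.
have -> : (j < J.+1)%N = (j == J) || (j < J)%N by rewrite ltnS leq_eqVlt.
rewrite big_ord_recr IH /= indicE.
have [<-|jJ] := eqVneq j J; first by rewrite ltnn mem_set// mulr1 add0r.
rewrite memNset ?mulr0 ?addr0// => /(disjB Bj) jJ'.
by rewrite jJ' eqxx in jJ.
Qed.

Lemma block_sum0 (c : nat -> R) J t : (forall j, ~ B j t) ->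
  \sum_(i < J) c i * \1_(B i) t = 0.
Proof. by move=> nB; rewrite big1// => i _; rewrite indicE memNset ?mulr0. Qed.

(** By disjointness at most one term is nonzero at [t], so the partial sums are eventually
    constant. *)
Lemma wsum_cvg t : wsum J t @[J --> \oo] --> weight t /\
  weight t = if pselect (exists j, B j t) is left e then (sval (cid e)).+1%:R^-1 else 0.
Proof.
have lim_eq (l : R) J0 : (forall J, (J0 <= J)%N -> wsum J t = l) ->
    wsum J t @[J --> \oo] --> weight t /\ weight t = l.
  move=> h; have c : wsum J t @[J --> \oo] --> l.
    by apply: cvg_near_cst; exists J0.
  have e : weight t = l := cvg_lim (@Rhausdorff R) c.
  by rewrite e.
case: pselect => [e|ne]; last first.
  by apply: (lim_eq _ 0%N) => J _; apply: (block_sum0 (fun i => i.+1%:R^-1)) => j Bj; apply: ne; exists j.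
case: cid => j Bj /=; apply: (lim_eq _ j.+1) => J jJ.
by rewrite /wsum (block_sum (fun i => i.+1%:R^-1) _ Bj) jJ.
Qed.

Lemma weightE j t : B j t -> weight t = j.+1%:R^-1.
Proof.
move=> Bj; rewrite (wsum_cvg t).2; case: pselect => [e|[]]; last by exists j.
by case: cid => i Bi /=; rewrite (disjB Bi Bj).
Qed.

Lemma weight_ge0 t : 0 <= weight t.
Proof. by rewrite (wsum_cvg t).2; case: pselect => // e; rewrite invr_ge0. Qed.

Lemma bmr_weight : bmr weight.
Proof.
split.
  apply: (@measurable_fun_cvg _ _ _ _ wsum) => [J|t _]; last exact: (wsum_cvg t).1.
  elim: J => [|J IH].
    by rewrite (_ : wsum 0 = cst 0)//; apply/funext => t; rewrite /wsum big_ord0.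
  rewrite (_ : wsum J.+1 = fun t => wsum J t + J.+1%:R^-1 * \1_(B J) t); last first.
    by apply/funext => t; rewrite /wsum big_ord_recr.
  apply: measurable_funD => //; apply: measurable_funM => //.
exists 1 => t; rewrite ger0_norm ?weight_ge0//.
rewrite (wsum_cvg t).2; case: pselect => // e.
by rewrite invf_le1// ler1n.
Qed.

Lemma bmr_dens J : bmr (dens J).
Proof.
elim: J => [|J IH].
  rewrite (_ : dens 0 = cst 0); first exact: bmr_cst.
  by apply/funext => t; rewrite /dens big_ord0.
rewrite (_ : dens J.+1 = fun t => dens J t + J.+1%:R * \1_(B J) t); last first.
  by apply/funext => t; rewrite /dens big_ord_recr.
by apply: bmrD => //; apply: bmrM; [exact: bmr_cst|exact: bmr_indic].
Qed.

Lemma dens_ge0 J t : 0 <= dens J t.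
Proof. by apply: sumr_ge0 => j _; rewrite mulr_ge0// indicE. Qed.

Lemma weight_dens f : exists J, forall t, f t != 0 -> weight t * dens J t = 1.
Proof.
have [J fJ] := bfun_supp f; exists J => t f0.
have [j [jJ Bj]] : exists j, (j < J)%N /\ B j t.
  apply: contrapT => h; move/eqP: f0; apply; apply: fJ => j jJ Bj.
  by apply: h; exists j.
by rewrite (weightE Bj) /dens (block_sum (fun i => i.+1%:R) _ Bj) jJ mulVf.
Qed.

Lemma bmf_weight : bmf (fun t => (weight t)%:C).
Proof. exact/bmf_real/bmr_weight. Qed.

Definition wform f g : R[i] := cint (fun t => (weight t)%:C * (f t * (g t)^*)).
Definition wnorm2 f : R := rint (fun t => weight t * normc (f t) ^+ 2).
Definition coef (f : R -> R[i]) (k : nat) : R[i] := cint (fun t => cexp k t * f t).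

(** Bessel's inequality: the duality bound with both weights equal to 1, Parseval providing the
    constant [2 * pi]. *)
Lemma coef_sqbounded f : sqbounded (coef f).
Proof.
exists (2 * pi * rint (fun t => 1 * normc (f t) ^+ 2)) => N.
apply: (@coef_bound _ N f (cst 1) (cst 1)); rewrite ?mulr_ge0 ?pi_ge0//.
- exact: bmr_cst.
- exact: bmr_cst.
- exact: bfun_bmf.
- by move=> t _; rewrite mulr1.
by move=> c; under eq_fun do rewrite mul1r; rewrite rint_tpoly.
Qed.

Lemma bmf_coef f (k : int) : bmf (fun t => cexp k t * f t).
Proof. exact: (bmfM (bmf_cexp _ k) (bfun_bmf f)). Qed.

(* The squared norm is the weighted L^2 norm plus the sum over [k >= 0] of
   [|cint (z^k f)|^2]. Multiplication by [z] shifts the coefficients and loses only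
   the first one. *)
Definition bdot f g : R[i] := wform f g + l2dot (coef f) (coef g).

Lemma bmf_wform f g : bmf (fun t => (weight t)%:C * (f t * (g t)^*)).
Proof.
exact: (bmfM bmf_weight (bmfM (bfun_bmf f) (bmf_conj (bfun_bmf g)))).
Qed.

Lemma coef_lin a f g k : coef (a *: f + g) k = a * coef f k + coef g k.
Proof.
have hf := bmf_coef f k; have hg := bmf_coef g k; have haf := bmfZ a hf.
rewrite /coef -cintZ// -cintD//.
by congr cint; apply/funext => t; rewrite bfunP; ring.
Qed.

Lemma bdotP a f g h : bdot (a *: f + g) h = a * bdot f h + bdot g h.
Proof.
rewrite /bdot.
have -> : wform (a *: f + g) h = a * wform f h + wform g h.
  have hf := bmf_wform f h; have hg := bmf_wform g h; have haf := bmfZ a hf.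
  rewrite /wform -cintZ// -cintD//.
  by congr cint; apply/funext => t; rewrite bfunP; ring.
have -> : coef (a *: f + g) = fun k => a * coef f k + coef g k.
  by apply/funext => k; exact: coef_lin.
by rewrite l2dot_lin; [ring|exact: coef_sqbounded..].
Qed.

Lemma bdotC f g : bdot g f = (bdot f g)^*.
Proof.
rewrite /bdot conjD -l2dotC; [|exact: coef_sqbounded..]; congr (_ + _).
have hf := bmf_wform f g.
rewrite /wform -cint_conj//; congr cint; apply/funext => t.
by rewrite conjMr conjM conjCK (mulrC (f t)^*).
Qed.

Lemma wformE f : wform f f = (wnorm2 f)%:C.
Proof.
rewrite /wform -cint_real; congr cint; apply/funext => t.
by rewrite mulJ -rmorphM.
Qed.

Lemma wnorm2_ge0 f : 0 <= wnorm2 f.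
Proof. by apply: rint_ge0 => t; rewrite mulr_ge0 ?weight_ge0 ?sqr_ge0. Qed.

Lemma Re_bdot f : complex.Re (bdot f f) = wnorm2 f + l2norm2 (coef f).
Proof. by rewrite /bdot wformE Re_D. Qed.

Lemma bdot_ge0 f : 0 <= complex.Re (bdot f f).
Proof. by rewrite Re_bdot addr_ge0 ?wnorm2_ge0// l2norm2_ge0//; exact: coef_sqbounded. Qed.

Definition block_preHilbert : preHilbert R := PreHilbert bdotP bdotC bdot_ge0.

End BlockForm.

(** * Bounds for multiplication operators and coefficients *)

Section BlockEstimates.
Variables (R : realType) (B : nat -> set R).
Hypothesis mB : forall j, measurable (B j).
Hypothesis disjB : forall i j t, B i t -> B j t -> i = j.
Hypothesis B_small : forall j, j.+1%:R * rint \1_(B j) <= 2^-1 ^+ j.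
Local Notation V := (blockfun B).
Local Notation P := (block_preHilbert mB disjB).
Local Notation wn := (@wnorm2 R B).
Implicit Types (f g : V) (a : R[i]).

Lemma pnorm_block f : pnorm (f : P) ^+ 2 = wn f + l2norm2 (coef f).
Proof. by rewrite pnorm_sqr [LHS](Re_bdot f). Qed.

Lemma b_ge0 j : 0 <= rint \1_(B j) :> R.
Proof. by apply: rint_ge0 => t; rewrite indicE. Qed.

(** A geometric series over the blocks; the induction carries its exact partial sums. *)
Lemma rint_dens (r : R -> R) (K : R) J : bmr r -> 0 <= K ->
  (forall j, j.+1%:R * rint (fun t => \1_(B j) t * r t) <= K * 2^-1 ^+ j) ->
  rint (fun t => dens B J t * r t) <= 2 * K.
Proof.
move=> br K0 hK.
have bj j : bmr (fun t => \1_(B j) t * r t) by apply: bmrM => //; exact: bmr_indic.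
have h n : rint (fun t => dens B n t * r t) <= K * (2 - 2 * 2^-1 ^+ n).
  elim: n => [|n IH].
    rewrite expr0 mulr1 subrr mulr0 -[leRHS](mulr0 (2 * pi)) -rint_cst.
    rewrite le_eqVlt; apply/orP; left; apply/eqP; congr rint; apply/funext => t.
    by rewrite /dens big_ord0 mul0r.
  have -> : (fun t => dens B n.+1 t * r t) =
      (fun t => dens B n t * r t + n.+1%:R * (\1_(B n) t * r t)).
    by apply/funext => t; rewrite /dens big_ord_recr mulrDl -mulrA.
  rewrite rintD; [|by apply: bmrM => //; exact: bmr_dens|exact: (bmrM (bmr_cst _) (bj n))].
  rewrite rintZ//; have := hK n; move: IH; rewrite exprS; move: (2^-1 ^+ n) => x.
  lra.
apply: (le_trans (h J)); have : 0 <= 2^-1 ^+ J :> R by rewrite exprn_ge0.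
by move: (2^-1 ^+ J) => x x0; have := mulr_ge0 K0 x0; lra.
Qed.

(** Cauchy-Schwarz against the inverse weight, whose total mass, the sum of the
    [j.+1 * rint \1_(B j)], is at most 2. *)
Lemma cint_block_bound f (g : R -> R[i]) (M : R) : bmf g ->
  (forall t, normc (g t) <= M) ->
  normc (cint (fun t => g t * f t)) ^+ 2 <= 2 * M ^+ 2 * wn f.
Proof.
move=> bg gM; have [J wd] := weight_dens disjB f.
have := cint_cauchy_schwarz (bmr_weight mB disjB) (weight_ge0 disjB) (bmr_dens mB J)
  (dens_ge0 B J) (bfun_bmf f) bg wd.
under eq_fun do rewrite mulrC; move=> /le_trans; apply.
rewrite [leRHS]mulrC ler_wpM2l ?wnorm2_ge0//.
have M0 : 0 <= M by apply: le_trans (gM 0); exact: normc_ge0.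
have bg2 := bmr_normc2 bg.
apply: rint_dens; rewrite ?sqr_ge0// => j.
apply: (@le_trans _ _ (j.+1%:R * (M ^+ 2 * rint \1_(B j)))).
  rewrite ler_wpM2l// -rintZ; last exact: bmr_indic.
  apply: le_rint => [||t].
  - by apply: bmrM => //; exact: bmr_indic.
  - by apply: bmrM; [exact: bmr_cst|exact: bmr_indic].
  rewrite mulrC ler_wpM2r ?indicE//.
  by rewrite ler_pXn2r ?nnegrE ?normc_ge0.
by rewrite mulrCA ler_wpM2l ?sqr_ge0.
Qed.

Lemma bmr_wn f : bmr (fun t => weight B t * normc (f t) ^+ 2).
Proof. exact: bmrM (bmr_weight mB disjB) (bmr_normc2 (bfun_bmf f)). Qed.

Lemma wnorm2_bmul (g : R -> R[i]) (bg : bmf g) (M : R) f : (forall t, normc (g t) <= M) ->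
  wn (bmul B bg f) <= M ^+ 2 * wn f.
Proof.
move=> gM; rewrite /wnorm2 -rintZ; last exact: bmr_wn.
apply: le_rint => [||t]; first exact: bmr_wn.
  by apply: bmrM; [exact: bmr_cst|exact: bmr_wn].
rewrite bmulE normcM exprMn mulrCA ler_wpM2r//.
  by rewrite mulr_ge0 ?sqr_ge0 ?weight_ge0.
by rewrite ler_pXn2r ?nnegrE ?normc_ge0// (le_trans _ (gM t))// normc_ge0.
Qed.

Definition shift (k : int) : {linear V -> V} := bmul B (bmf_cexp R k).

Lemma wnorm2_shift k f : wn (shift k f) = wn f.
Proof.
congr rint; apply/funext => t.
by rewrite bmulE normcM normc_cexp mul1r.
Qed.

Lemma coef_shift1 f : coef (shift 1 f) = fun k => coef f k.+1.
Proof.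
apply/funext => k; congr cint; apply/funext => t.
by rewrite bmulE mulrA -cexpD -PoszD addn1.
Qed.

Lemma shift_defect f g : pdot (shift 1 f : P) (shift 1 g) =
  pdot (f : P) g - coef f 0 * (coef g 0)^*.
Proof.
rewrite /pdot /= /bdot !coef_shift1 (l2dot_shift (coef_sqbounded f) (coef_sqbounded g)).
have -> : wform (shift 1 f) (shift 1 g) = wform f g.
  congr cint; apply/funext => t; rewrite !bmulE conjM mulrACA mulJ normc_cexp.
  by rewrite expr1n mul1r.
ring.
Qed.

Lemma shiftK k f : shift (- k) (shift k f) = f.
Proof. by apply: blockfun_eq => t; rewrite !bmulE mulrA cexpNK mul1r. Qed.

Lemma iter_shift n f : iter n (shift (-1)) f = shift (- n%:Z) f.
Proof.
elim: n => [|n IH] /=.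
  by apply: blockfun_eq => t; rewrite bmulE oppr0 cexp0 mul1r.
rewrite IH; apply: blockfun_eq => t; rewrite !bmulE mulrA -cexpD.
by rewrite -opprD -PoszD add1n.
Qed.

Lemma tpoly_sup n c (t : R) :
  normc (tpoly n c t) ^+ 2 <= n%:R * \sum_(i < n) normc (c i) ^+ 2.
Proof.
have h1 : normc (tpoly n c t) <= \sum_(i < n) normc (c i).
  rewrite /tpoly; elim: n => [|n IH]; first by rewrite !big_ord0 normc0.
  rewrite !big_ord_recr; apply: (le_trans (normcD _ _)); apply: lerD => //.
  by rewrite normcM normc_cexp mulr1.
set X := \sum_(i < n) normc (c i) in h1.
have X0 : 0 <= X by apply: sumr_ge0 => i _; exact: normc_ge0.
apply: (@le_trans _ _ (X ^+ 2)).
  by rewrite ler_pXn2r ?nnegrE ?normc_ge0.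
have h2 s : 2 * s * X <= s ^+ 2 * (\sum_(i < n) normc (c i) ^+ 2) + n%:R.
  have -> : n%:R = \sum_(i < n) (1 : R) by rewrite sumr_const card_ord.
  rewrite !mulr_sumr -big_split.
  apply: ler_sum => i _ /=; have := sqr_ge0 (s * normc (c i) - 1).
  by rewrite sqrrB exprMn; lra.
apply: discr_le; rewrite ?sqr_ge0//.
  by apply: sumr_ge0 => i _; exact: sqr_ge0.
(* [discr_le] is used with [k = X ^+ 2], whereas [h2] is linear in [X]; hence the parameter
   [s * X]. *)
move=> s; have := h2 (s * X); rewrite exprMn; move: (\sum_(_ < _) _) => S; lra.
Qed.

Variable U : nat -> R.
Hypothesis U_ge0 : forall n, 0 <= U n.
Hypothesis B_growth : forall j n,
  j.+1%:R * n%:R * rint \1_(B j) <= 2^-1 ^+ j \/ j.+1%:R * 2 ^+ j <= U n.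

Definition kappa n : R := 2 * (1 + 2 * pi * U n).

Lemma kappa_ge0 n : 0 <= kappa n.
Proof. by rewrite mulr_ge0// addr_ge0// mulr_ge0// mulr_ge0// pi_ge0. Qed.

(* The block [B j] contributes at most a multiple of [2^-1 ^+ j], either because it
   is too small to be seen by polynomials of length [n], or because [U n] already
   dominates [j.+1]. *)
Lemma dens_tpoly n c J :
  rint (fun t => dens B J t * normc (tpoly n c t) ^+ 2) <=
  kappa n * \sum_(i < n) normc (c i) ^+ 2.
Proof.
set S := \sum_(_ < _) _.
have S0 : 0 <= S by apply: sumr_ge0 => i _; exact: sqr_ge0.
have bq := bmr_normc2 (bmf_tpoly n c).
have pi0 : 0 <= (2 * pi : R) by rewrite mulr_ge0// pi_ge0.
have piU : 0 <= 2 * pi * U n by rewrite mulr_ge0.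
rewrite /kappa -mulrA; apply: rint_dens => //; first by rewrite mulr_ge0// addr_ge0.
move=> j; have e0 : 0 <= 2^-1 ^+ j :> R by rewrite exprn_ge0.
have bj : bmr (fun t => \1_(B j) t * normc (tpoly n c t) ^+ 2).
  by apply: bmrM => //; exact: bmr_indic.
(* A small block is met with the sup bound [n * S] of [tpoly_sup]; otherwise Parseval over the whole
   circle suffices, as [j.+1 <= U n * 2^-1 ^+ j]. *)
have [h|h] := B_growth j n.
  apply: (@le_trans _ _ (j.+1%:R * (n%:R * S * rint \1_(B j)))).
    rewrite ler_wpM2l// -rintZ; last exact: bmr_indic.
    apply: le_rint => // [|t]; first exact: bmrM (bmr_cst _) (bmr_indic (mB j)).
    by rewrite mulrC ler_wpM2r ?indicE//; exact: tpoly_sup.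
  have := ler_wpM2r S0 h; have := mulr_ge0 (mulr_ge0 piU S0) e0.
  move: (2^-1 ^+ j) (rint _) (2 * pi * U n) => x b p; lra.
have : rint (fun t => \1_(B j) t * normc (tpoly n c t) ^+ 2) <= 2 * pi * S.
  rewrite -rint_tpoly; apply: le_rint => // t.
  by rewrite ler_piMl ?sqr_ge0// indicE; case: (_ \in _).
move=> /(ler_wpM2l (ler0n R j.+1)) h1; apply: (le_trans h1).
have h2 : j.+1%:R <= U n * 2^-1 ^+ j by rewrite exprVn ler_pdivlMr// exprn_gt0.
have := ler_wpM2r (mulr_ge0 pi0 S0) h2; have := mulr_ge0 S0 e0.
move: (2^-1 ^+ j) (j.+1%:R) (2 * pi) => x b p; lra.
Qed.

(** These are the coefficients of [f] of index [-n] to [-1], invisible in its norm until [z^-n]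
    brings them in. *)
Lemma coef_head n f :
  sqsum n (coef (shift (- n%:Z) f)) <= kappa n * wn f.
Proof.
have [J wd] := weight_dens disjB (shift (- n%:Z) f).
rewrite -(wnorm2_shift (- n%:Z)).
apply: (coef_bound (bmr_weight mB disjB) (weight_ge0 disjB) (bmr_dens mB J)
  (dens_ge0 B J) (bfun_bmf _) wd (kappa_ge0 n)) => c.
exact: dens_tpoly.
Qed.

Lemma coef_shiftN n f k : coef (shift (- n%:Z) f) (n + k)%N = coef f k.
Proof.
congr cint; apply/funext => t.
by rewrite bmulE mulrA -cexpD PoszD addrAC subrr add0r.
Qed.

Lemma sqsum_cat n m (a : nat -> R[i]) :
  sqsum (n + m) a = sqsum n a + sqsum m (fun k => a (n + k)%N).
Proof.
elim: m => [|m IH]; first by rewrite addn0 [sqsum 0 _]big_ord0 addr0.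
by rewrite addnS !sqsumS IH addrA.
Qed.

Lemma iter_shift_bound n f :
  pnorm (iter n (shift (-1)) f : P) <= Num.sqrt (1 + kappa n) * pnorm (f : P).
Proof.
have k0 := kappa_ge0 n; have k1 : 0 <= 1 + kappa n by rewrite addr_ge0.
rewrite -(@ler_pXn2r _ 2)// ?nnegrE ?pnorm_ge0 ?mulr_ge0 ?sqrtr_ge0 ?pnorm_ge0//.
rewrite iter_shift [leRHS]exprMn [X in _ <= X * _](sqr_sqrtr k1).
rewrite [leLHS]pnorm_block [X in _ <= _ * X]pnorm_block wnorm2_shift.
have l0 := l2norm2_ge0 (coef_sqbounded f).
have h : l2norm2 (coef (shift (- n%:Z) f)) <= kappa n * wn f + l2norm2 (coef f).
  apply: l2norm2_le => N; apply: (@le_trans _ _ (sqsum (n + N) (coef (shift (- n%:Z) f)))).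
    rewrite addnC sqsum_cat lerDl; exact: sqsum_ge0.
  rewrite sqsum_cat; apply: lerD; first exact: coef_head.
  have -> : (fun k => coef (shift (- n%:Z) f) (n + k)%N) = coef f.
    by apply/funext => k; exact: coef_shiftN.
  exact: le_l2norm2 (coef_sqbounded f).
have := mulr_ge0 k0 l0; move: h (wnorm2_ge0 disjB f) {k1 k0 l0}.
move: (l2norm2 _) (l2norm2 _) (wn f) (kappa n) => x y w k; lra.
Qed.

Lemma indicator_supp j :
  exists J, forall t, (forall i, (i < J)%N -> ~ B i t) -> (\1_(B j) t)%:C = 0 :> R[i].
Proof. by exists j.+1 => t /(_ j (leqnn _)) Bj; rewrite indicE memNset. Qed.

Definition indicator j : V := Blockfun (bmf_real (bmr_indic (mB j))) (indicator_supp j).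

Lemma wnorm2_indicator j : wn (indicator j) = rint \1_(B j) / j.+1%:R.
Proof.
rewrite mulrC -rintZ; last exact: bmr_indic.
congr rint; apply/funext => t.
have -> : indicator j t = (\1_(B j) t)%:C by [].
rewrite normc_real indicE.
have [/set_mem Bj|_] := boolP (t \in B j); last by rewrite normr0 expr0n mulr0 mulr0.
by rewrite (weightE disjB Bj) normr1 expr1n.
Qed.

(** The factor [cexp k x] leaves the modulus unchanged and recentres the phase at [x]; the integrand
    then has real part at least one half on the block. *)
Lemma coef_indicator j (x : R) (k : nat) :
  (forall t, B j t -> 1 / 2 <= cos (k%:R * (t - x))) ->
  rint \1_(B j) / 2 <= normc (cint (fun t => cexp (- k%:Z) t * indicator j t)).
Proof.
move=> hcos.
have bi := bfun_bmf (indicator j).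
have bk := bmfM (bmf_cexp R (- k%:Z)) bi.
have -> : normc (cint (fun t => cexp (- k%:Z) t * indicator j t)) =
    normc (cint (fun t => cexp k x * (cexp (- k%:Z) t * indicator j t))).
  by rewrite cintZ// normcM normc_cexp mul1r.
apply: le_trans (le_trans (ler_norm _) (normc_Re _)).
rewrite [_ / 2]mulrC -rintZ; last exact: bmr_indic.
apply: le_rint => [||t]; first exact: bmrM (bmr_cst _) (bmr_indic (mB j)).
  by case: (bmfZ (cexp k x) bk).
have -> : indicator j t = (\1_(B j) t)%:C by [].
rewrite mulrA [X in complex.Re X]mulrC Re_Mr indicE.
have [/set_mem Bj|_] := boolP (t \in B j); last by rewrite mulr0 mul0r.
rewrite mulr1 mul1r -div1r; have -> : complex.Re (cexp k x * cexp (- k%:Z) t) =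
    cos (k%:R * (t - x)).
  by rewrite /cexp /= intrN mulNr cosN sinN mulrN opprK mulrBr cosB; ring.
exact: hcos.
Qed.

End BlockEstimates.
(** * The resolvent outside the set *)

Section BlockSpectrum.
Variables (R : realType) (B : nat -> set R).
Hypothesis mB : forall j, measurable (B j).
Hypothesis disjB : forall i j t, B i t -> B j t -> i = j.
Hypothesis B_small : forall j, j.+1%:R * rint \1_(B j) <= 2^-1 ^+ j.
Local Notation V := (blockfun B).
Local Notation P := (block_preHilbert mB disjB).
Local Notation wn := (@wnorm2 R B).
Local Notation shift := (@shift R B).
Local Notation indicator := (indicator mB).
Implicit Types (f g : V).

Lemma bmr_inv_max (r : R -> R) (c : R) : bmr r -> 0 < c ->
  bmr (fun t => (Num.max (r t) c)^-1).
Proof.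
move=> [mr _] c0; have max0 x : 0 < Num.max x c by rewrite lt_max c0 orbT.
split.
  apply: (@measurableT_comp _ _ _ _ _ _ (fun x : R => (Num.max x c)^-1)) => //.
  apply: continuous_measurable_fun => x.
  apply: (@continuousV _ _ (fun x : R => Num.max x c)); first by rewrite gt_eqF.
  rewrite (_ : (fun x : R => Num.max x c) = fun x => (x + c + `|x - c|) / 2); last first.
    by apply/funext => y; rewrite maxr_absE.
  apply: cvgMl; apply: cvgD; first by apply: cvgD; [exact: cvg_id|exact: cvg_cst].
  by apply: cvg_norm; apply: cvgB; [exact: cvg_id|exact: cvg_cst].
exists c^-1 => t; rewrite ger0_norm ?invr_ge0 ?(ltW (max0 _))//.
by rewrite lef_pV2 ?posrE// le_max lexx orbT.
Qed.

(* On the set where [d <= |z - lam|], [r] is [1 / (z - lam)] written as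
   [(z - lam)^* / |z - lam|^2]; the maximum makes it total and bounded. *)
Lemma ex_resolvent_fun (lam : R[i]) (d : R) : 0 < d -> exists r : R -> R[i],
  [/\ bmf r, forall t, normc (r t) <= d^-1 &
      forall t, d <= normc (cexp 1 t - lam) -> r t * (cexp 1 t - lam) = 1].
Proof.
move=> d0; pose z t : R[i] := cexp 1 t - lam.
have bz : bmf z.
  have := bmfD (bmf_cexp R 1) (bmf_cst (- lam)); exact.
have d20 : 0 < d ^+ 2 by rewrite exprn_gt0.
pose s t := (Num.max (normc (z t) ^+ 2) (d ^+ 2))^-1.
have bs : bmr s by apply: bmr_inv_max => //; exact: bmr_normc2.
exists (fun t => (s t)%:C * (z t)^*); split.
- exact: bmfM (bmf_real bs) (bmf_conj bz).
- move=> t; rewrite normcM normc_real normc_conj.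
  have m0 : 0 < Num.max (normc (z t) ^+ 2) (d ^+ 2) by rewrite lt_max d20 orbT.
  rewrite ger0_norm ?invr_ge0 ?(ltW m0)// mulrC ler_pdivrMr// mulrC ler_pdivlMr//.
  have [h|h] := leP d (normc (z t)).
    by rewrite le_max; apply/orP; left; rewrite expr2 ler_wpM2l ?normc_ge0.
  by rewrite le_max; apply/orP; right; rewrite expr2 ler_wpM2r ?ltW.
move=> t dz; rewrite -/(z t) -mulrA (mulrC (z t)^*) mulJ -rmorphM /s.
have h : d ^+ 2 <= normc (z t) ^+ 2 by rewrite ler_pXn2r ?nnegrE ?normc_ge0 ?(ltW d0).
by rewrite max_l// mulVf// gt_eqF// (lt_le_trans d20).
Qed.

Lemma ex_distance (E : set R[i]) (lam : R[i]) : closed (E : set R[i]^o) -> ~ E lam ->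
  exists d : R, 0 < d /\ forall z, E z -> d <= normc (z - lam).
Proof.
move=> cE nE; have /open_nbhs_nbhs : open_nbhs (lam : R[i]^o) (~` E).
  by split=> //; exact: closed_openC.
move=> /nbhs_ballP[[e e'] /= e0 he].
have [e'0 {}e0] : e' = 0 /\ 0 < e.
  by move: e0; rewrite ltcE /= => /andP[/eqP].
exists e; split=> // z Ez; rewrite leNgt; apply/negP => ze.
apply: (he z) Ez; rewrite -ball_normE /ball_/= normE e'0 ltcR.
by rewrite normcB.
Qed.

Section Resolvent.
Variables (lam : R[i]) (d : R) (r : R -> R[i]).
Hypothesis d0 : 0 < d.
Hypothesis br : bmf r.
Hypothesis r_le : forall t, normc (r t) <= d^-1.
Hypothesis r_inv : forall j t, B j t -> r t * (cexp 1 t - lam) = 1.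

Definition resolvent : {linear V -> V} := bmul B br.

Lemma blockfun_support f t : f t = 0 \/ exists j, B j t.
Proof.
have [J fJ] := bfun_supp f.
have [h|h] := pselect (exists j, B j t); [by right|left].
by apply: fJ => j _ Bj; apply: h; exists j.
Qed.

Lemma resolventK f : resolvent (shift 1 f - lam *: f) = f.
Proof.
apply: blockfun_eq => t; rewrite bmulE bfunB bfunZ bmulE -mulrBl mulrA.
by have [->|[j /r_inv ->]] := blockfun_support f t; rewrite ?mulr0 ?mul1r.
Qed.

Lemma resolventKV f : shift 1 (resolvent f) - lam *: resolvent f = f.
Proof.
apply: blockfun_eq => t; rewrite bfunB bfunZ !bmulE -mulrBl mulrA (mulrC _ (r t)).
by have [->|[j /r_inv ->]] := blockfun_support f t; rewrite ?mulr0 ?mul1r.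
Qed.

Lemma iter_resolventE k f t : iter k resolvent f t = r t ^+ k * f t.
Proof.
elim: k => [|k IH]; first by rewrite expr0 mul1r.
by rewrite iterS bmulE IH exprS mulrA.
Qed.

Lemma coef_resolvent f n :
  coef (resolvent f) n.+1 = lam * coef (resolvent f) n + coef f n.
Proof.
have h : lam *: resolvent f + f = shift 1 (resolvent f).
  by rewrite -{2}(resolventKV f) addrC subrK.
by rewrite -coef_lin h coef_shift1.
Qed.

Lemma bmf_exp k : bmf (fun t => r t ^+ k).
Proof.
elim: k => [|k IH]; first by under eq_fun do rewrite expr0; exact: bmf_cst.
by under eq_fun do rewrite exprS; exact: bmfM.
Qed.

(** The weighted norm alone controls these coefficients, through [|z^n r^k| <= d^-k]. This is the a
    priori geometric growth that [sqsum_unimodular] requires. *)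
Lemma coef_iter_le k f n :
  normc (coef (iter k resolvent f) n) <= Num.sqrt (2 * wn f) * d^-1 ^+ k.
Proof.
have w0 := wnorm2_ge0 disjB f; have d0' : 0 <= d^-1 by rewrite invr_ge0 ltW.
rewrite -(@ler_pXn2r _ 2)// ?nnegrE ?normc_ge0 ?mulr_ge0 ?sqrtr_ge0 ?exprn_ge0//.
rewrite [leRHS]exprMn [X in _ <= X * _]sqr_sqrtr ?mulr_ge0//.
have -> : coef (iter k resolvent f) n = cint (fun t => cexp n t * r t ^+ k * f t).
  by congr cint; apply/funext => t; rewrite iter_resolventE mulrA.
have bg := bmfM (bmf_cexp R n) (bmf_exp k).
apply: le_trans (cint_block_bound mB disjB B_small f bg (M := d^-1 ^+ k) _) _.
  move=> t; rewrite normcM normc_cexp mul1r.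
  elim: (k) => [|i IH]; first by rewrite !expr0 normc1.
  by rewrite !exprS normcM ler_pM ?normc_ge0.
by rewrite mulrAC.
Qed.

Lemma resolvent_coef_bound : exists2 K, 0 <= K & forall f,
  l2norm2 (coef (resolvent f)) <= K * (wn f + l2norm2 (coef f)).
Proof.
pose M f := 2 * wn f * d^-1 ^+ 2.
have d2 : 0 <= d^-1 ^+ 2 by rewrite exprn_ge0// invr_ge0 ltW.
have bM f n : normc (coef (resolvent f) n) ^+ 2 <= M f.
  have w0 := wnorm2_ge0 disjB f.
  have h := coef_iter_le 1 f n; rewrite expr1 in h.
  apply: (@le_trans _ _ ((Num.sqrt (2 * wn f) * d^-1) ^+ 2)).
    rewrite ler_pXn2r ?nnegrE ?normc_ge0 ?mulr_ge0 ?sqrtr_ge0//.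
    by rewrite invr_ge0 ltW.
  by rewrite exprMn [X in X * _ <= _]sqr_sqrtr ?mulr_ge0.
have aS f N := le_l2norm2 N (coef_sqbounded f).
have final (q : R) : 0 <= q -> (forall f N,
    sqsum N (coef (resolvent f)) <= q * (l2norm2 (coef f) + M f)) ->
    exists2 K, 0 <= K & forall f,
      l2norm2 (coef (resolvent f)) <= K * (wn f + l2norm2 (coef f)).
  move=> q0 hq; exists (q * (1 + 2 * d^-1 ^+ 2)).
    by rewrite mulr_ge0// addr_ge0// mulr_ge0.
  move=> f; apply: (le_trans (l2norm2_le (hq f))).
  rewrite -mulrA ler_wpM2l// /M.
  have := wnorm2_ge0 disjB f; have := l2norm2_ge0 (coef_sqbounded f).
  move: (wn f) (l2norm2 _) (d^-1 ^+ 2) d2 => w l e e0 l0 w0.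
  by have := mulr_ge0 e0 l0; lra.
have [l1|l1|l1] := ltgtP (normc lam) 1.
- apply: (final ((2 / (1 - normc lam)) ^+ 2)); first exact: sqr_ge0.
  move=> f N; exact: sqsum_contracting l1 (coef_resolvent f) (aS f) (bM f).
- apply: (final ((1 - (normc lam)^-1)^-1 ^+ 2)); first exact: sqr_ge0.
  move=> f N; exact: sqsum_expanding l1 (coef_resolvent f) (aS f) (bM f).
(* [sqsum_unimodular] is applied with [m ^+ 2 = 2 * wn f], which equals [d ^+ 2 * M f]. *)
apply: (final (2 / d ^+ 2 * (1 + (4 / d + 1) * d ^+ 2))).
  rewrite mulr_ge0 ?divr_ge0 ?exprn_ge0 ?addr_ge0 ?mulr_ge0 ?addr_ge0 ?divr_ge0 ?exprn_ge0//;
  exact: ltW.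
move=> f N; have w0 := wnorm2_ge0 disjB f.
have rec k n : coef (iter k.+1 resolvent f) n.+1 =
    lam * coef (iter k.+1 resolvent f) n + coef (iter k resolvent f) n.
  by rewrite iterS coef_resolvent.
have := sqsum_unimodular (b := fun k => coef (iter k resolvent f)) N l1 d0
  (sqrtr_ge0 _) rec (fun k n => coef_iter_le k f n) (aS f).
have w2 : 0 <= 2 * wn f by rewrite mulr_ge0.
move=> /le_trans; apply; rewrite [Num.sqrt _ ^+ 2](sqr_sqrtr w2) /M -[leRHS]mulrA.
have h0 : 0 <= 2 / d ^+ 2 by rewrite divr_ge0// exprn_ge0// ltW.
apply: ler_wpM2l => //.
have e1 : d^-1 ^+ 2 * d ^+ 2 = 1 by rewrite -exprMn mulVf ?gt_eqF// expr1n.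
have := l2norm2_ge0 (coef_sqbounded f).
have D0 : 0 <= 4 / d + 1 by rewrite addr_ge0// divr_ge0// ltW.
move: (wn f) w0 (l2norm2 (coef f)) (4 / d + 1) D0 (d ^+ 2) (d^-1 ^+ 2) e1 d2 (sqr_ge0 d).
move=> w w0 l D D0 p q e1 q0 p0 l0.
have -> : (1 + D * p) * (l + 2 * w * q) =
    l + D * (2 * w) * (q * p) + (2 * w * q + D * p * l) by ring.
by rewrite e1 mulr1 lerDl addr_ge0// !mulr_ge0.
Qed.

Lemma resolvent_bound : exists C, 0 <= C /\ forall f,
  pnorm (resolvent f : P) <= C * pnorm (f : P).
Proof.
have [K K0 hK] := resolvent_coef_bound.
have d2 : 0 <= d^-1 ^+ 2 by rewrite exprn_ge0// invr_ge0 ltW.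
have c0 : 0 <= d^-1 ^+ 2 + K by rewrite addr_ge0.
exists (Num.sqrt (d^-1 ^+ 2 + K)); split; first exact: sqrtr_ge0.
move=> f; rewrite -(@ler_pXn2r _ 2)// ?nnegrE ?pnorm_ge0 ?mulr_ge0 ?sqrtr_ge0 ?pnorm_ge0//.
rewrite [leRHS]exprMn [X in _ <= X * _](sqr_sqrtr c0).
rewrite [leLHS]pnorm_block [X in _ <= _ * X]pnorm_block mulrDl.
apply: lerD; last exact: hK.
apply: le_trans (wnorm2_bmul mB disjB br f r_le) _.
apply: ler_wpM2l => //; rewrite lerDl; exact: l2norm2_ge0 (coef_sqbounded f).
Qed.

End Resolvent.

Variable c : R.
Hypothesis c0 : 0 < c.
Hypothesis B_scale : forall j, exists x (n : nat),
  [/\ (0 < n)%N, c <= n%:R * rint \1_(B j) &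
    forall t (k : nat), B j t -> (k <= n)%N -> 1 / 2 <= cos (k%:R * (t - x))].

Lemma indicator_gt0 j : 0 < rint \1_(B j) :> R.
Proof.
have [x [n [n0 cn _]]] := B_scale j.
rewrite lt_def b_ge0 andbT; apply: contraTneq cn => ->.
by rewrite mulr0 -ltNge.
Qed.

Lemma coef_indicator0 j : coef (indicator j) 0 = (rint \1_(B j))%:C.
Proof.
rewrite -cint_real; congr cint; apply/funext => t.
by rewrite cexp0 mul1r.
Qed.

(** The two estimates make the squared ratio of [q] to [p] at least [c * j / 8], whence the
    threshold on [j]. *)
Lemma ratio_gt (C b j p q : R) : 0 < b -> 0 < j -> 0 <= q -> p ^+ 2 <= 2 * b / j ->
  c * b / 4 <= q ^+ 2 -> 8 * C ^+ 2 / c < j -> C * p < q.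
Proof.
move=> b0 j0 q0 hp hq; rewrite ltr_pdivrMr// => hj.
rewrite ltNge; apply/negP => h.
have h2 : q ^+ 2 <= (C * p) ^+ 2 by rewrite ler_pXn2r ?nnegrE// (le_trans q0).
have h3 : (C * p) ^+ 2 <= C ^+ 2 * (2 * b / j) by rewrite exprMn ler_wpM2l ?sqr_ge0.
have := le_trans hq (le_trans h2 h3); rewrite mulrA ler_pdivlMr// => h5.
have : b * (j * c) <= b * (8 * C ^+ 2) by lra.
by rewrite ler_pM2l// leNgt hj.
Qed.

(** The test vector is [z^N] times the indicator of a late block, with [N] so large that its
    coefficients weigh no more than its weighted norm. Going back [N + n] steps uncovers [n]
    coefficients of size at least [b / 2], where [n * b >= c]. *)
Lemma iter_shift_unbounded C : exists n (f : P), (1 <= n)%N /\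
  C * pnorm f < pnorm (iter n (shift (-1)) f : P).
Proof.
pose j := Num.truncn (8 * C ^+ 2 / c).
have [x [n [n0 cn hcos]]] := B_scale j.
have b0 := indicator_gt0 j; set b := rint _ in cn b0.
have j0 : 0 < j.+1%:R :> R by [].
pose g := indicator j.
have [N hN] := l2norm2_tail (coef_sqbounded g) (divr_gt0 b0 j0).
pose f : V := shift N%:Z g.
exists (N + n)%N, f; split; first by rewrite addn_gt0 n0 orbT.
have iterE : iter (N + n) (shift (-1)) f = shift (- n%:Z) g.
  rewrite iter_shift; apply: blockfun_eq => t; rewrite !bmulE mulrA -cexpD.
  by rewrite PoszD opprD addrAC addNr add0r.
have fE : coef f = fun k => coef g (N + k)%N.
  apply/funext => k; congr cint; apply/funext => t.
  by rewrite bmulE mulrA -cexpD -PoszD addnC.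
have f2 : pnorm (f : P) ^+ 2 <= 2 * b / j.+1%:R.
  rewrite pnorm_block fE wnorm2_shift wnorm2_indicator//.
  rewrite -/b -mulrA mulr2n mulrDl mul1r; exact: lerD.
have g2 : c * b / 4 <= pnorm (iter (N + n) (shift (-1)) f : P) ^+ 2.
  rewrite iterE pnorm_block; apply: ler_wpDl; first exact: wnorm2_ge0.
  apply: le_trans (le_l2norm2 n (coef_sqbounded _)).
  apply: (@le_trans _ _ (\sum_(i < n) (b / 2) ^+ 2)).
    rewrite sumr_const card_ord -[_ *+ n]mulr_natl.
    by have := ler_wpM2r (ltW b0) cn; lra.
  apply: ler_sum => i _; rewrite ler_pXn2r ?nnegrE ?normc_ge0 ?divr_ge0 ?(ltW b0)//.
  have -> : coef (shift (- n%:Z) g) i = cint (fun t => cexp (- (n - i)%N%:Z) t * g t).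
    congr cint; apply/funext => t; rewrite bmulE mulrA -cexpD.
    by rewrite -subzn ?(ltnW (ltn_ord i))// opprB.
  apply: (coef_indicator mB (x := x)) => t Bt; apply: hcos => //.
  exact: leq_subr.
exact: ratio_gt b0 j0 (pnorm_ge0 _) f2 g2 (truncnS_gt _).
Qed.

End BlockSpectrum.
(** This holds for unbounded maps too, because [sup] is then 0 by default. *)
Lemma opnorm_ge0 (R : realType) (H : hilbertType R) (T : H -> H) : 0 <= opnorm T.
Proof.
rewrite /opnorm; set S := [set _ | _ in _].
have [hS|] := pselect (has_sup S); last by move=> /sup_out ->.
have [y Sy] := hS.1; apply: (@le_trans _ _ y); last by apply: ub_le_sup; [exact: hS.2|].
by have [x _ <-] := Sy; have := normr_ge0 (T x); rewrite lecE => /andP[].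
Qed.

Theorem theorem1p6 (R : realType) (E : set R[i]) (clE : closed (E : set R[i]^o))
    (subE : E `<=` @unit_circle R) (posE : (0 < circle_measure E)%E)
    (u : nat -> R) (u_gt0 : forall n, (1 <= n)%N -> 0 < u n)
    (u_infty : u @ \oo --> +oo) :
  exists (H : hilbertType R) (T : {linear H -> H}),
    [/\ bounded_operator T, opnorm T <= 1, spectrum T `<=` E &
    exists Tinv Tstar : {linear H -> H},
      [/\ inverse_operator T Tinv,
          adjoint_operator T Tstar,
          (fun n => opnorm (iter n Tinv)) =O_\oo u,
          has_rank (fun x => x - Tstar (T x)) 1 &
          ereal_sup [set (opnorm (iter n Tinv))%:E | n in [set n | (1 <= n)%N]]
            = +oo%E]].
Proof.
have posA : positive_set (arc E).
  split; [exact: measurable_arc| |exact: posE].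
  by move=> t [/andP[t0 t2] _] /=; rewrite in_itv /= t0 ltW.
have [B [c [c0 mB BA disjB Bj]]] := ex_blocks posA u_infty.
have B_small j : j.+1%:R * rint \1_(B j) <= 2^-1 ^+ j by have [] := Bj j.
have B_scale j := let: And3 _ _ h := Bj j in h.
(* The absolute value makes the sequence nonnegative at index 0 too, where [u] has no prescribed
   sign. *)
have B_growth j n : j.+1%:R * n%:R * rint \1_(B j) <= 2^-1 ^+ j \/
    j.+1%:R * 2 ^+ j <= `|u n|.
  have [_ h _] := Bj j; have [h1|h1] := h n; [by left|right].
  exact: le_trans h1 (ler_norm _).
pose P := block_preHilbert mB disjB.
pose K n : R := Num.sqrt (1 + kappa (fun n => `|u n|) n).
have [|||||||||H [T [bT T1 sT [Tinv [Tstar [h1 h2 h3 h4 h5]]]]]] :=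
  @rank_one_defect_model R P E (shift B 1) (shift B (-1)) (fun f => coef f 0) K.
- by move=> a f g; exact: coef_lin.
- exact: shift_defect.
- exact: (shiftK 1).
- by move=> f; rewrite -{1}(opprK 1); exact: (shiftK (-1)).
- by move=> n; exact: sqrtr_ge0.
- by move=> n f; exact: iter_shift_bound.
- move=> lam nE; have [d [d0 dE]] := ex_distance clE nE.
  have [r [br r_le r_inv]] := ex_resolvent_fun lam d0.
  have rB j t : B j t -> r t * (cexp 1 t - lam) = 1.
    move=> /BA[_ Et]; apply: r_inv; apply: dE.
    by rewrite /cexp mul1r.
  have [C [C0 hC]] := resolvent_bound mB disjB B_small d0 br r_le rB.
  exists (resolvent B br), C; split=> // f.
    exact: resolventK.
  exact: resolventKV.
- exists (indicator mB 0); rewrite coef_indicator0 eq_complex negb_and /=.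
  by rewrite gt_eqF// (indicator_gt0 c0 B_scale).
- by move=> C; exact: (iter_shift_unbounded mB disjB c0 B_scale).
exists H, T; split=> //; exists Tinv, Tstar; split=> //.
have pi0 : 0 <= (pi : R) by exact: pi_ge0.
(* Here [1 + kappa n] is [3 + 4 * pi * u n], and its square root is at most [(3 + 4 * pi) * u n] as
   soon as [u n >= 1]. *)
apply/eqO_exP; exists (3 + 4 * pi); first by rewrite /=; lra.
have /cvgryPge/(_ 1) u1 := u_infty.
near=> n.
have un : 1 <= u n by near: n.
rewrite ger0_norm ?opnorm_ge0// (ger0_norm (le_trans ler01 un)).
apply: (le_trans (h3 n)); rewrite /K /kappa (ger0_norm (le_trans ler01 un)).
have un0 : 0 <= u n := le_trans ler01 un.
have b0 : 0 <= (3 + 4 * pi) * u n by rewrite mulr_ge0//; lra.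
rewrite -(@ler_pXn2r _ 2)// ?nnegrE ?sqrtr_ge0// sqr_sqrtr; last first.
  by rewrite addr_ge0// mulr_ge0// addr_ge0// !mulr_ge0.
have h6 : u n <= u n ^+ 2 by rewrite expr2 ler_peMr.
have h7 := mulr_ge0 pi0 (sqr_ge0 (u n)); have h8 := mulr_ge0 pi0 h7.
have h9 := ler_wpM2l pi0 h6.
by rewrite exprMn; move: (u n) (u n ^+ 2) un h6 h7 h8 h9 => v w *; lra.
Unshelve. all: by end_near. Qed.
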